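(* Let $k$ be a field of characteristic zero and $\lambda\in k$. Let $\mathcal{H}_{\mathrm{CM}}^\lambda$ be the Hopf algebra described in the context and $\mathcal{I}$ its two-sided ideal generated by $\{t_n-t_2^{\,n-1}\}_{n\ge3}$. Then the quotient bialgebra $k_\lambda[\mathrm{Heis}]:=\mathcal{H}_{\mathrm{CM}}^\lambda/\mathcal{I}$ is a Hopf algebra, generated by $X$, $Y$, $t=2t_2$ satisfying $$[Y,X]=\lambda X,\quad [X,t]=\tfrac12\lambda t^2,\quad [Y,t]=\lambda t,$$ $$\Delta(X)=1\otimes X+X\otimes1+Y\otimes t,\quad \Delta(Y)=Y\otimes1+1\otimes Y,\quad \Delta(t)=t\otimes1+1\otimes t,$$ $$S(Y)=-Y,\quad S(X)=-X+Yt,\quad S(t)=-t,\quad \varepsilon(X)=\varepsilon(Y)=\varepsilon(t)=0 .$$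
   Context: $\mathcal{H}_{\mathrm{CM}}^\lambda$ is the Hopf algebra over $k$ with generators $X,Y,t_n$ ($n\ge1$, $t_1=1$), the $t_n$ commuting with each other, with relations $[Y,X]=\lambda X$, $[Y,t_n]=\lambda(n-1)t_n$, $[X,t_n]=\lambda((n+1)t_{n+1}-2t_2t_n)$, coproduct $\Delta(X)=X\otimes1+1\otimes X+Y\otimes2t_2$, $\Delta(Y)=Y\otimes1+1\otimes Y$, $\Delta(t_n)=\sum_{k=1}^nt_k\otimes\sum_{i_1+\dots+i_k=n}t_{i_1}\cdots t_{i_k}$ (indices $i_j\ge1$), counit $\varepsilon(X)=\varepsilon(Y)=0$, $\varepsilon(t_n)=\delta_{n,1}$, and antipode determined by these, with $S(X)=-X+2Yt_2$, $S(Y)=-Y$. The ideal $\mathcal{I}$ satisfies $\Delta(\mathcal{I})\subseteq\mathcal{H}_{\mathrm{CM}}^\lambda\otimes\mathcal{I}+\mathcal{I}\otimes\mathcal{H}_{\mathrm{CM}}^\lambda$ and $\varepsilon(\mathcal{I})=0$, so the quotient is a bialgebra. *)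

(* Defs.v *)
From HB Require Import structures.
From mathcomp Require Import all_boot all_order all_algebra.
From mathcomp Require Import generic_quotient finmap boolp.
From mathcomp.multinomials Require Import monalg.

Set Implicit Arguments.
Unset Strict Implicit.
Unset Printing Implicit Defensive.

Import GRing.Theory.
Local Open Scope ring_scope.
Local Open Scope quotient_scope.

(* The operations of the quotient and tensor structures below are locked, so
   that unification never unfolds them. *)
Fact op_key : unit. Proof. exact: tt. Qed.

Record subspace (k : fieldType) (V : lmodType k) := Subspace {
  insub_space :> V -> Prop;
  sub0 : insub_space 0;
  subD : forall x y, insub_space x -> insub_space y -> insub_space (x + y);
  subZ : forall (a : k) x, insub_space x -> insub_space (a *: x)
}.

Section Span.
Variables (k : fieldType) (V : lmodType k) (S : V -> Prop).

Inductive in_span : V -> Prop :=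
| span0 : in_span 0
| span_mem x : S x -> in_span x
| spanD x y : in_span x -> in_span y -> in_span (x + y)
| spanZ (a : k) x : in_span x -> in_span (a *: x).

Definition lspan : subspace V := Subspace span0 spanD spanZ.

End Span.

Section QuotientSpace.
Variables (k : fieldType) (V : lmodType k) (W : subspace V).
Implicit Types x y z : V.

Lemma subN x : W x -> W (- x).
Proof. by move=> Wx; rewrite -scaleN1r; apply: subZ. Qed.

Definition quot_rel x y : bool := `[< W (x - y) >].

Lemma quot_rel_class : equiv_class_of quot_rel.
Proof.
split=> [x|x y|y x z].
- by apply/asboolP; rewrite subrr; apply: sub0.
- by apply/asboolP/asboolP=> /subN; rewrite opprB.
- move=> /asboolP xy /asboolP yz; apply/asboolP.
  by rewrite -[x](subrK y) -addrA; apply: subD.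
Qed.

Canonical quot_rel_equiv := EquivRelPack quot_rel_class.

Definition quot_space : Type := {eq_quot quot_rel_equiv}.
HB.instance Definition _ := Choice.on quot_space.

Definition quot_pi : V -> quot_space :=
  locked_with op_key (\pi_({eq_quot quot_rel_equiv})).
Definition quot_repr (q : quot_space) : V :=
  repr (q : {eq_quot quot_rel_equiv}).

Lemma quot_reprK q : quot_pi (quot_repr q) = q.
Proof. by rewrite /quot_pi locked_withE; apply: reprK. Qed.

Lemma quot_piP x y : quot_pi x = quot_pi y <-> W (x - y).
Proof.
rewrite /quot_pi locked_withE; split=> [h|h].
  by apply/asboolP/(@eqmodP _ quot_rel_equiv).
exact/(@eqmodP _ quot_rel_equiv)/asboolP.
Qed.

Lemma quot_repr_pi x : W (quot_repr (quot_pi x) - x).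
Proof. by apply/quot_piP; rewrite quot_reprK. Qed.

Definition qadd := locked_with op_key
  (fun p q => quot_pi (quot_repr p + quot_repr q)).
Definition qopp := locked_with op_key (fun p => quot_pi (- quot_repr p)).
Definition qscale := locked_with op_key
  (fun (a : k) p => quot_pi (a *: quot_repr p)).

Lemma qaddE x y : qadd (quot_pi x) (quot_pi y) = quot_pi (x + y).
Proof.
by rewrite /qadd locked_withE; apply/quot_piP; rewrite opprD addrACA; apply: subD; apply: quot_repr_pi.
Qed.

Lemma qoppE x : qopp (quot_pi x) = quot_pi (- x).
Proof. by rewrite /qopp locked_withE; apply/quot_piP; rewrite -opprD; apply/subN/quot_repr_pi. Qed.

Lemma qscaleE a x : qscale a (quot_pi x) = quot_pi (a *: x).
Proof. by rewrite /qscale locked_withE; apply/quot_piP; rewrite -scalerBr; apply/subZ/quot_repr_pi. Qed.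

Fact qaddA : associative qadd.
Proof.
move=> p q r; rewrite -(quot_reprK p) -(quot_reprK q) -(quot_reprK r).
by rewrite !qaddE addrA.
Qed.

Fact qaddC : commutative qadd.
Proof.
by move=> p q; rewrite -(quot_reprK p) -(quot_reprK q) !qaddE addrC.
Qed.

Fact qadd0 : left_id (quot_pi 0) qadd.
Proof. by move=> p; rewrite -(quot_reprK p) qaddE add0r. Qed.

Fact qaddN : left_inverse (quot_pi 0) qopp qadd.
Proof. by move=> p; rewrite -(quot_reprK p) qoppE qaddE addNr. Qed.

HB.instance Definition _ :=
  GRing.isZmodule.Build quot_space qaddA qaddC qadd0 qaddN.

Fact qscaleA a b p : qscale a (qscale b p) = qscale (a * b) p.
Proof. by rewrite -(quot_reprK p) !qscaleE scalerA. Qed.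

Fact qscale1 : left_id 1 qscale.
Proof. by move=> p; rewrite -(quot_reprK p) qscaleE scale1r. Qed.

Fact qscaleDr : right_distributive qscale +%R.
Proof.
move=> a p q; rewrite -(quot_reprK p) -(quot_reprK q).
by rewrite qscaleE qscaleE [RHS]qaddE [_ + _]qaddE qscaleE scalerDr.
Qed.

Fact qscaleDl p : {morph qscale^~ p : a b / a + b}.
Proof.
move=> a b; rewrite -(quot_reprK p).
by rewrite !qscaleE [RHS]qaddE scalerDl.
Qed.

HB.instance Definition _ := GRing.Zmodule_isLmodule.Build k quot_space
  qscaleA qscale1 qscaleDr qscaleDl.

Fact quot_pi_linear : linear quot_pi.
Proof. by move=> a x y; rewrite -qaddE -qscaleE. Qed.

HB.instance Definition _ :=
  GRing.isLinear.Build k V quot_space _ quot_pi quot_pi_linear.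

(* [quot_lift f] is the map induced by [f] on the quotient; it is only
   meaningful when [f] is linear and vanishes on [W]. *)
Definition quot_lift (T : Type) (f : V -> T) : quot_space -> T :=
  locked_with op_key (fun q => f (quot_repr q)).

Lemma quot_liftE (U : lmodType k) (f : V -> U) :
  linear f -> (forall x, W x -> f x = 0) ->
  forall x, quot_lift f (quot_pi x) = f x.
Proof.
move=> lf f0 x; rewrite /quot_lift locked_withE; set r := quot_repr _.
have -> : r = 1 *: (r - x) + x by rewrite scale1r subrK.
by rewrite lf f0 ?scaler0 ?add0r //; apply: quot_repr_pi.
Qed.

Lemma quot_lift_linear (U : lmodType k) (f : V -> U) :
  linear f -> (forall x, W x -> f x = 0) -> linear (quot_lift f).
Proof.
move=> lf f0 a p q; rewrite -(quot_reprK p) -(quot_reprK q).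
by rewrite -quot_pi_linear !quot_liftE // lf.
Qed.

End QuotientSpace.

Lemma linear_map0 (k : fieldType) (V U : lmodType k) (f : V -> U) :
  linear f -> f 0 = 0.
Proof. by move=> lf; have := lf (-1) 0 0; rewrite scaler0 addr0 scaleN1r addNr. Qed.

Lemma lspan_vanish (k : fieldType) (V U : lmodType k) (S : V -> Prop)
    (f : V -> U) :
  linear f -> (forall x, S x -> f x = 0) -> forall x, lspan S x -> f x = 0.
Proof.
move=> lf fS x; have f0 := linear_map0 lf.
elim=> [//|{}x /fS //|{}x y _ fx _ fy|a {}x _ fx].
- by rewrite -[x]scale1r lf fx fy scale1r addr0.
- by rewrite -[a *: x]addr0 lf fx f0 scaler0 addr0.
Qed.

Section GeneratedIdeal.
Variables (k : fieldType) (A : algType k) (S : A -> Prop).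

Inductive in_ideal : A -> Prop :=
| ideal0 : in_ideal 0
| ideal_mem x : S x -> in_ideal x
| idealD x y : in_ideal x -> in_ideal y -> in_ideal (x + y)
| idealMl a x : in_ideal x -> in_ideal (a * x)
| idealMr x a : in_ideal x -> in_ideal (x * a).

Lemma idealZ (c : k) x : in_ideal x -> in_ideal (c *: x).
Proof. by move=> Ix; rewrite -mulr_algl; apply: idealMl. Qed.

End GeneratedIdeal.

(* Properness is required because an [algType] is a nonzero ring. *)
Record ideal (k : fieldType) (A : algType k) := Ideal {
  ideal_space :> subspace A;
  ideal_Ml : forall a x, ideal_space x -> ideal_space (a * x);
  ideal_Mr : forall x a, ideal_space x -> ideal_space (x * a);
  ideal_proper : ~ ideal_space 1
}.

Definition gen_ideal (k : fieldType) (A : algType k) (S : A -> Prop)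
    (S1 : ~ in_ideal S 1) : ideal A :=
  @Ideal k A (Subspace (@ideal0 k A S) (@idealD k A S) (@idealZ k A S))
    (@idealMl k A S) (@idealMr k A S) S1.

Section QuotientAlgebra.
Variables (k : fieldType) (A : algType k) (I : ideal A).

Definition quot_alg : Type := quot_space I.
HB.instance Definition _ := GRing.Lmodule.on quot_alg.

Definition alg_pi : A -> quot_alg := @quot_pi k A I.
HB.instance Definition _ := GRing.Linear.on alg_pi.

Lemma alg_piP x y : alg_pi x = alg_pi y <-> I (x - y).
Proof. exact: quot_piP. Qed.

Lemma alg_pi_surj q : exists x, alg_pi x = q.
Proof. by exists (quot_repr q); apply: quot_reprK. Qed.

Definition qmul : quot_alg -> quot_alg -> quot_alg := locked_with op_key
  (fun p q => alg_pi (quot_repr p * quot_repr q)).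

Lemma qmulE x y : qmul (alg_pi x) (alg_pi y) = alg_pi (x * y).
Proof.
rewrite /qmul locked_withE; apply/alg_piP; set x' := quot_repr _; set y' := quot_repr _.
have -> : x' * y' - x * y = (x' - x) * y' + x * (y' - y).
  by rewrite mulrBl mulrBr addrA subrK.
by apply: subD; [apply: ideal_Mr|apply: ideal_Ml]; apply: quot_repr_pi.
Qed.

Fact qmulA : associative qmul.
Proof.
move=> p q r; case: (alg_pi_surj p) (alg_pi_surj q) (alg_pi_surj r).
by move=> x <- [y <-] [z <-]; rewrite !qmulE mulrA.
Qed.

Fact qmul1l : left_id (alg_pi 1) qmul.
Proof. by move=> p; case: (alg_pi_surj p) => x <-; rewrite qmulE mul1r. Qed.

Fact qmul1r : right_id (alg_pi 1) qmul.
Proof. by move=> p; case: (alg_pi_surj p) => x <-; rewrite qmulE mulr1. Qed.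

Fact qmulDl : left_distributive qmul +%R.
Proof.
move=> p q r; case: (alg_pi_surj p) (alg_pi_surj q) (alg_pi_surj r).
by move=> x <- [y <-] [z <-]; rewrite -linearD !qmulE -linearD mulrDl.
Qed.

Fact qmulDr : right_distributive qmul +%R.
Proof.
move=> p q r; case: (alg_pi_surj p) (alg_pi_surj q) (alg_pi_surj r).
by move=> x <- [y <-] [z <-]; rewrite -linearD !qmulE -linearD mulrDr.
Qed.

Fact qone_neq0 : alg_pi 1 != 0.
Proof.
apply/eqP; rewrite -(linear0 alg_pi) => /alg_piP; rewrite subr0.
exact: ideal_proper.
Qed.

HB.instance Definition _ := GRing.Zmodule_isNzRing.Build quot_alg
  qmulA qmul1l qmul1r qmulDl qmulDr qone_neq0.

Fact alg_pi_monoid : monoid_morphism alg_pi.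
Proof. by split=> // x y; rewrite -qmulE. Qed.

Lemma alg_piZ (a : k) x : alg_pi (a *: x) = a *: alg_pi x.
Proof. exact: linearZ. Qed.

Fact qscaleAl (a : k) (p q : quot_alg) : a *: (p * q) = a *: p * q.
Proof.
case: (alg_pi_surj p) (alg_pi_surj q) => x <- [y <-].
by rewrite -alg_pi_monoid.2 -!alg_piZ -alg_pi_monoid.2 scalerAl.
Qed.

HB.instance Definition _ := GRing.Lmodule_isLalgebra.Build k quot_alg qscaleAl.

Fact qscaleAr (a : k) (p q : quot_alg) : a *: (p * q) = p * (a *: q).
Proof.
case: (alg_pi_surj p) (alg_pi_surj q) => x <- [y <-].
by rewrite -alg_pi_monoid.2 -!alg_piZ -alg_pi_monoid.2 scalerAr.
Qed.

HB.instance Definition _ := GRing.Lalgebra_isAlgebra.Build k quot_alg qscaleAr.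

HB.instance Definition _ :=
  GRing.isMonoidMorphism.Build A quot_alg alg_pi alg_pi_monoid.

End QuotientAlgebra.


Section LinearExtension.
Variables (k : fieldType) (K : choiceType) (W : lmodType k).

Definition malg_ext (f : K -> W) (g : {malg k[K]}) : W :=
  \sum_(p <- msupp g) g@_p *: f p.

Lemma malg_extEw f (d : {fset K}) g : (msupp g `<=` d)%fset ->
  malg_ext f g = \sum_(p <- d) g@_p *: f p.
Proof.
move=> le; rewrite [LHS](big_fset_incl _ le) => //= x xd /mcoeff_outdom ->.
by rewrite scale0r.
Qed.

Lemma malg_extU f c p : malg_ext f << c *g p >> = c *: f p.
Proof. by rewrite (malg_extEw _ msuppU_le) big_seq_fset1 mcoeffUU. Qed.

Lemma malg_ext_linear f : linear (malg_ext f).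
Proof.
move=> a g h; pose d := (msupp g `|` msupp h)%fset.
have lg : (msupp g `<=` d)%fset by apply: fsubsetUl.
have lh : (msupp h `<=` d)%fset by apply: fsubsetUr.
have lgh : (msupp (a *: g + h) `<=` d)%fset.
  apply: (fsubset_trans (msuppD_le _ _)); apply: fsetSU; exact: msuppZ_le.
rewrite !(malg_extEw _ (d := d)) // scaler_sumr -big_split /=.
by apply: eq_bigr => p _; rewrite mcoeffD mcoeffZ scalerDl scalerA.
Qed.

HB.instance Definition _ f :=
  GRing.isLinear.Build k {malg k[K]} W _ (malg_ext f) (malg_ext_linear f).

Lemma malg_span (S : {malg k[K]} -> Prop) :
  S 0 -> (forall x y, S x -> S y -> S (x + y)) ->
  (forall c p, S << c *g p >>) -> forall g, S g.
Proof.
by move=> S0 SD SU g; rewrite (monalgE g); elim/big_ind: _ => // p _.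
Qed.

End LinearExtension.

Definition bilinear_map (k : fieldType) (U V W : lmodType k)
    (f : U -> V -> W) : Prop :=
  (forall v, linear (f^~ v)) /\ (forall u, linear (f u)).

Section Tensor.
Variables (k : fieldType) (U V : lmodType k).

Inductive tens_rel : {malg k[(U * V)%type]} -> Prop :=
| tens_rel_l a u u' v :
    tens_rel (<< (a *: u + u', v) >> - (a *: << (u, v) >> + << (u', v) >>))
| tens_rel_r a u v v' :
    tens_rel (<< (u, a *: v + v') >> - (a *: << (u, v) >> + << (u, v') >>)).

Definition tens : Type := quot_space (lspan tens_rel).
HB.instance Definition _ := GRing.Lmodule.on tens.

Definition tpure (u : U) (v : V) : tens :=
  quot_pi (lspan tens_rel) << (u, v) >>.

(* The linear map induced by [f]; only meaningful when [f] is bilinear, see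
   [tens_liftE] and [tens_lift_linear]. *)
Definition tens_lift (W : lmodType k) (f : U -> V -> W) : tens -> W :=
  quot_lift (malg_ext (fun p => f p.1 p.2)).

Lemma tpure_bilinear : bilinear_map tpure.
Proof.
split=> [v a u u'|u a v v']; rewrite /tpure -quot_pi_linear.
  by apply/quot_piP/span_mem/tens_rel_l.
by apply/quot_piP/span_mem/tens_rel_r.
Qed.

Section Lift.
Variables (W : lmodType k) (f : U -> V -> W).
Hypothesis bf : bilinear_map f.

Fact tens_lift_vanish x :
  lspan tens_rel x -> malg_ext (fun p => f p.1 p.2) x = 0.
Proof.
apply: (lspan_vanish (malg_ext_linear _)) => {x} _ [a u u' v|a u v v'];
  rewrite linearB linearP /= !malg_extU !scale1r /=.
  by rewrite (bf.1 v) subrr.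
by rewrite (bf.2 u) subrr.
Qed.

Lemma tens_liftE u v : tens_lift f (tpure u v) = f u v.
Proof.
rewrite /tens_lift quot_liftE ?malg_extU ?scale1r //.
  exact: malg_ext_linear.
exact: tens_lift_vanish.
Qed.

Lemma tens_lift_linear : linear (tens_lift f).
Proof. exact: quot_lift_linear (malg_ext_linear _) tens_lift_vanish. Qed.

End Lift.

Lemma tens_ind (S : tens -> Prop) :
  S 0 -> (forall x y, S x -> S y -> S (x + y)) ->
  (forall u v, S (tpure u v)) -> forall x, S x.
Proof.
move=> S0 SD SU x; rewrite -(quot_reprK x).
elim/malg_span: (quot_repr x) => [|g h Sg Sh|c [u v]].
- by rewrite linear0.
- by rewrite linearD; apply: SD.
have -> : << c *g (u, v) >> = c *: << (u, v) >> :> {malg k[(U * V)%type]}.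
  by apply/malgP => p; rewrite mcoeffZ !mcoeffU mulr_natr.
have := tpure_bilinear.1 v c u 0; rewrite addr0.
rewrite (linear_map0 (tpure_bilinear.1 v)).
by rewrite addr0 linearZ /= -/(tpure u v) => <-.
Qed.

Lemma eq_tens (W : lmodType k) (f g : tens -> W) :
  linear f -> linear g ->
  (forall u v, f (tpure u v) = g (tpure u v)) -> f =1 g.
Proof.
move=> lf lg fg; apply: tens_ind => //.
- by rewrite !linear_map0.
- by move=> x y fx fy; rewrite -[x]scale1r lf lg fx fy.
Qed.

Lemma tens_lift_comb (W : lmodType k) (f g h : U -> V -> W) a x :
  (forall u v, f u v = a *: g u v + h u v) ->
  tens_lift f x = a *: tens_lift g x + tens_lift h x.
Proof.
move=> fgh; rewrite /tens_lift /quot_lift !locked_withE /malg_ext scaler_sumr -big_split /=.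
by apply: eq_bigr => p _; rewrite fgh scalerDr !scalerA mulrC.
Qed.

End Tensor.

Arguments tens {k} (U V)%_type.
Notation "U ⊗ V" := (tens U V) (at level 40, left associativity) : type_scope.
Notation "u ⊗ v" := (tpure u v) (at level 40, left associativity) : ring_scope.

Section TensorMaps.
Variable k : fieldType.
Implicit Types U V W : lmodType k.

Definition tens_map U V U' V' (f : U -> U') (g : V -> V') : U ⊗ V -> U' ⊗ V' :=
  tens_lift (fun u v => f u ⊗ g v).

Definition tens_assoc U V W : (U ⊗ V) ⊗ W -> U ⊗ (V ⊗ W) :=
  tens_lift (fun x w => tens_lift (fun u v => u ⊗ (v ⊗ w)) x).

Lemma tens_map_bilinear U V U' V' (f : U -> U') (g : V -> V') :
  linear f -> linear g -> bilinear_map (fun u v => f u ⊗ g v).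
Proof.
move=> lf lg; split=> [v a u u'|u a v v'].
  by rewrite lf (tpure_bilinear _ _).1.
by rewrite lg (tpure_bilinear _ _).2.
Qed.

Lemma tens_assoc_bilinear1 U V W (w : W) :
  bilinear_map (fun (u : U) (v : V) => u ⊗ (v ⊗ w)).
Proof.
split=> [v a u u'|u a v v']; first by rewrite (tpure_bilinear _ _).1.
by rewrite (tpure_bilinear _ _).1 (tpure_bilinear _ _).2.
Qed.

Lemma tens_assoc_bilinear U V W :
  bilinear_map (fun (x : U ⊗ V) (w : W) =>
    tens_lift (fun u v => u ⊗ (v ⊗ w)) x).
Proof.
split=> [w|x a w w']; first by apply: tens_lift_linear; apply: tens_assoc_bilinear1.
apply: tens_lift_comb => u v.
by rewrite (tpure_bilinear _ _).2 (tpure_bilinear _ _).2.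
Qed.

Lemma tens_mapE U V U' V' (f : U -> U') (g : V -> V') u v :
  linear f -> linear g -> tens_map f g (u ⊗ v) = f u ⊗ g v.
Proof. by move=> lf lg; apply/tens_liftE/tens_map_bilinear. Qed.

Lemma tens_map_linear U V U' V' (f : U -> U') (g : V -> V') :
  linear f -> linear g -> linear (tens_map f g).
Proof. by move=> lf lg; apply/tens_lift_linear/tens_map_bilinear. Qed.

Lemma tens_assocE U V W (u : U) (v : V) (w : W) :
  tens_assoc (u ⊗ v ⊗ w) = u ⊗ (v ⊗ w).
Proof.
rewrite /tens_assoc (tens_liftE (tens_assoc_bilinear _ _ _)).
by apply: tens_liftE; apply: tens_assoc_bilinear1.
Qed.

Lemma tens_assoc_linear U V W : linear (@tens_assoc U V W).
Proof. exact/tens_lift_linear/tens_assoc_bilinear. Qed.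

End TensorMaps.

(* The tensor product algebra: (a ⊗ b) * (a' ⊗ b') = (a * a') ⊗ (b * b'). *)
Section TensorAlgebra.
Variables (k : fieldType) (A B : algType k).
Implicit Types x y z : A ⊗ B.

Definition tens_mul : A ⊗ B -> A ⊗ B -> A ⊗ B := locked_with op_key
  (fun x y =>
    tens_lift (fun a b => tens_lift (fun a' b' => (a * a') ⊗ (b * b')) y) x).

Fact tens_mul_bilinear1 (a : A) (b : B) :
  bilinear_map (fun a' b' => (a * a') ⊗ (b * b')).
Proof.
apply: (@tens_map_bilinear _ _ _ _ _ (fun a' => a * a') (fun b' => b * b')).
  by move=> c u v; rewrite mulrDr scalerAr.
by move=> c u v; rewrite mulrDr scalerAr.
Qed.

Fact tens_mul_bilinear2 y :
  bilinear_map (fun (a : A) (b : B) =>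
    tens_lift (fun a' b' => (a * a') ⊗ (b * b')) y).
Proof.
split=> [b c a a'|a c b b']; apply: tens_lift_comb => u v.
  by rewrite mulrDl -scalerAl (tpure_bilinear _ _).1.
by rewrite mulrDl -scalerAl (tpure_bilinear _ _).2.
Qed.

Fact tens_mul_linear_l y : linear (tens_mul^~ y).
Proof.
rewrite /tens_mul locked_withE.
by apply: tens_lift_linear; apply: tens_mul_bilinear2.
Qed.

Fact tens_mul_linear_r x : linear (tens_mul x).
Proof.
rewrite /tens_mul locked_withE => c y z; apply: tens_lift_comb => a b.
by apply: tens_lift_linear; apply: tens_mul_bilinear1.
Qed.

Fact tens_mulE a b a' b' :
  tens_mul (a ⊗ b) (a' ⊗ b') = (a * a') ⊗ (b * b').
Proof.
rewrite /tens_mul locked_withE (tens_liftE (tens_mul_bilinear2 _)).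
by apply: tens_liftE; apply: tens_mul_bilinear1.
Qed.

Fact tens_mulDl : left_distributive tens_mul +%R.
Proof.
by move=> x y z; have := tens_mul_linear_l z 1 x y; rewrite !scale1r.
Qed.

Fact tens_mulDr : right_distributive tens_mul +%R.
Proof.
by move=> x y z; have := tens_mul_linear_r x 1 y z; rewrite !scale1r.
Qed.

Fact tens_mul0l : left_zero 0 tens_mul.
Proof. by move=> x; apply: (addrI (tens_mul 0 x)); rewrite -tens_mulDl !addr0. Qed.

Fact tens_mul0r : right_zero 0 tens_mul.
Proof. by move=> x; apply: (addrI (tens_mul x 0)); rewrite -tens_mulDr !addr0. Qed.

Fact tens_mulA : associative tens_mul.
Proof.
move=> x y z; elim/tens_ind: x => [|x x' hx hx'|a b].
- by rewrite !tens_mul0l.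
- by rewrite !tens_mulDl hx hx'.
elim/tens_ind: y => [|y y' hy hy'|a' b'].
- by rewrite !(tens_mul0l, tens_mul0r).
- by rewrite !(tens_mulDl, tens_mulDr) hy hy'.
elim/tens_ind: z => [|z z' hz hz'|a'' b''].
- by rewrite !tens_mul0r.
- by rewrite !tens_mulDr hz hz'.
by rewrite !tens_mulE !mulrA.
Qed.

Fact tens_mul1l : left_id (1 ⊗ 1) tens_mul.
Proof.
move=> x; elim/tens_ind: x => [|x y hx hy|a b]; first exact: tens_mul0r.
  by rewrite tens_mulDr hx hy.
by rewrite tens_mulE !mul1r.
Qed.

Fact tens_mul1r : right_id (1 ⊗ 1) tens_mul.
Proof.
move=> x; elim/tens_ind: x => [|x y hx hy|a b]; first exact: tens_mul0l.
  by rewrite tens_mulDl hx hy.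
by rewrite tens_mulE !mulr1.
Qed.

HB.instance Definition _ := GRing.Zmodule_isPzRing.Build (A ⊗ B)%type
  tens_mulA tens_mul1l tens_mul1r tens_mulDl tens_mulDr.

Lemma tpureM (a a' : A) (b b' : B) :
  (a ⊗ b) * (a' ⊗ b') = (a * a') ⊗ (b * b').
Proof. exact: tens_mulE. Qed.

Lemma tpure1 : 1 ⊗ 1 = 1 :> A ⊗ B.
Proof. by []. Qed.

End TensorAlgebra.

Arguments quot_alg {k A}.
Arguments alg_pi {k A}.

(* [A ⊗ A] is not declared as an [algType], whose instances must be proved
   nonzero; hence multiplicativity of the coproduct is a separate field. *)
Record bialgebra (k : fieldType) (A : algType k) := Bialgebra {
  comul : {linear A -> (A ⊗ A)%type};
  counit : {lrmorphism A -> k^o};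
  comul_monoid : monoid_morphism comul;
  coassoc : forall a : A,
    tens_assoc (tens_map comul idfun (comul a))
      = tens_map idfun comul (comul a);
  counit_l : forall a : A,
    tens_lift (fun x y => (counit x : k) *: y) (comul a) = a;
  counit_r : forall a : A,
    tens_lift (fun x y => (counit y : k) *: x) (comul a) = a
}.

Record hopf_algebra (k : fieldType) (A : algType k) := HopfAlgebra {
  hopf_bialgebra :> bialgebra A;
  antipode : {linear A -> A};
  antipode_l : forall a : A,
    tens_lift (fun x y => antipode x * y) (comul hopf_bialgebra a)
      = (counit hopf_bialgebra a : k) *: 1;
  antipode_r : forall a : A,
    tens_lift (fun x y => x * antipode y) (comul hopf_bialgebra a)
      = (counit hopf_bialgebra a : k) *: 1
}.

(* The span of the pure tensors a ⊗ b with a or b in I is A ⊗ I + I ⊗ A. *)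
Definition biideal (k : fieldType) (A : algType k) (B : bialgebra A)
    (I : ideal A) : Prop :=
  (forall x, I x ->
     lspan (fun z => exists a b, (I a \/ I b) /\ z = a ⊗ b) (comul B x)) /\
  (forall x, I x -> (counit B x : k) = 0).

Section QuotientBialgebra.
Variables (k : fieldType) (A : algType k) (B : bialgebra A) (I : ideal A).
Hypothesis bI : biideal B I.

Local Notation Q := (quot_alg I).
Local Notation p := (alg_pi I).

Definition quot_comul : Q -> Q ⊗ Q :=
  quot_lift (fun a => tens_map p p (comul B a)).
Definition quot_counit : Q -> k^o := quot_lift (counit B).

Fact linear_mcomp (U V W : lmodType k) (f : V -> W) (g : U -> V) :
  linear f -> linear g -> linear (fun x => f (g x)).
Proof. by move=> lf lg a x y; rewrite lg lf. Qed.

Fact id_linear (U : lmodType k) : linear (@idfun U).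
Proof. by []. Qed.

Fact pi_linear : linear p. Proof. exact: linearP. Qed.
Fact comul_linear : linear (comul B). Proof. exact: linearP. Qed.
Fact counit_linear : linear (counit B : A -> k^o). Proof. exact: linearP. Qed.

Let lpp := tens_map_linear pi_linear pi_linear.
Let lppc := linear_mcomp lpp comul_linear.

Fact quot_comul_vanish x : I x -> tens_map p p (comul B x) = 0.
Proof.
move=> /bI.1; apply: (lspan_vanish lpp) => _ [a [b [Iab ->]]].
rewrite (tens_mapE _ _ pi_linear pi_linear).
have pI c : I c -> p c = 0.
  by move=> Ic; rewrite -(linear0 p); apply/alg_piP; rewrite subr0.
case: Iab => /pI ->; first exact: (linear_map0 ((tpure_bilinear _ _).1 _)).
exact: (linear_map0 ((tpure_bilinear _ _).2 _)).
Qed.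

Fact quot_comulE a : quot_comul (p a) = tens_map p p (comul B a).
Proof. exact: quot_liftE lppc quot_comul_vanish _. Qed.

Fact quot_comul_linear : linear quot_comul.
Proof. exact: quot_lift_linear lppc quot_comul_vanish. Qed.

HB.instance Definition _ :=
  GRing.isLinear.Build k Q (Q ⊗ Q)%type _ quot_comul quot_comul_linear.

Fact quot_counitE a : quot_counit (p a) = counit B a.
Proof. exact: quot_liftE counit_linear bI.2 _. Qed.

Fact quot_counit_linear : linear quot_counit.
Proof. exact: quot_lift_linear counit_linear bI.2. Qed.

HB.instance Definition _ :=
  GRing.isLinear.Build k Q k^o _ quot_counit quot_counit_linear.

Fact quot_counit_monoid : monoid_morphism quot_counit.
Proof.
split=> [|x y]; first by rewrite -(rmorph1 p) quot_counitE rmorph1.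
case: (alg_pi_surj x) (alg_pi_surj y) => a <- [b <-].
by rewrite -rmorphM !quot_counitE rmorphM.
Qed.

HB.instance Definition _ :=
  GRing.isMonoidMorphism.Build Q k^o quot_counit quot_counit_monoid.

Fact tens_map_pi_monoid : monoid_morphism (tens_map p p).
Proof.
have mE a b : tens_map p p (a ⊗ b) = p a ⊗ p b.
  by rewrite (tens_mapE _ _ pi_linear pi_linear).
have mD : {morph tens_map p p : x y / x + y}.
  by move=> x y; have := lpp 1 x y; rewrite !scale1r.
have m0 : tens_map p p 0 = 0 := linear_map0 lpp.
split=> [|x y]; first by rewrite -tpure1 mE rmorph1.
elim/tens_ind: x => [|x x' hx hx'|a b].
- by rewrite m0 !mul0r.
- by rewrite mulrDl !mD hx hx' mulrDl.
elim/tens_ind: y => [|y y' hy hy'|a' b'].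
- by rewrite m0 !mulr0.
- by rewrite mulrDr !mD hy hy' mulrDr.
by rewrite tpureM !mE !rmorphM tpureM.
Qed.

Fact quot_comul_monoid : monoid_morphism quot_comul.
Proof.
have [c1 cM] := comul_monoid B; have [t1 tM] := tens_map_pi_monoid.
split=> [|x y]; first by rewrite -(rmorph1 p) quot_comulE c1 t1.
case: (alg_pi_surj x) (alg_pi_surj y) => a <- [b <-].
by rewrite -rmorphM !quot_comulE cM tM.
Qed.

Fact quot_coassoc q :
  tens_assoc (tens_map quot_comul idfun (quot_comul q))
    = tens_map idfun quot_comul (quot_comul q).
Proof.
case: (alg_pi_surj q) => a <-; rewrite quot_comulE.
have lc := quot_comul_linear; have lid := @id_linear Q.
have lc' := comul_linear; have lid' := @id_linear A.
have lp := pi_linear; pose m3 := tens_map p (tens_map p p).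
have lm3 : linear m3 := tens_map_linear lp lpp.
have eL x : tens_map quot_comul idfun (tens_map p p x)
    = tens_map (tens_map p p) p (tens_map (comul B) idfun x).
  move: x; apply: eq_tens => [||u v].
  - exact: linear_mcomp (tens_map_linear lc lid) lpp.
  - exact: linear_mcomp (tens_map_linear lpp lp) (tens_map_linear lc' lid').
  by rewrite (tens_mapE _ _ lp lp) (tens_mapE _ _ lc lid) (tens_mapE _ _ lc' lid')
    (tens_mapE _ _ lpp lp) quot_comulE.
have eR x : tens_map idfun quot_comul (tens_map p p x)
    = m3 (tens_map idfun (comul B) x).
  move: x; apply: eq_tens => [||u v].
  - exact: linear_mcomp (tens_map_linear lid lc) lpp.
  - exact: linear_mcomp lm3 (tens_map_linear lid' lc').
  by rewrite (tens_mapE _ _ lp lp) (tens_mapE _ _ lid lc) (tens_mapE _ _ lid' lc')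
    /m3 (tens_mapE _ _ lp lpp) quot_comulE.
have eA y : tens_assoc (tens_map (tens_map p p) p y) = m3 (tens_assoc y).
  have la := @tens_assoc_linear k A A A; have la' := @tens_assoc_linear k Q Q Q.
  have lL := linear_mcomp la' (tens_map_linear lpp lp).
  have lR := linear_mcomp lm3 la.
  move: y; apply: eq_tens => // x w.
  have lw : linear (fun x => x ⊗ w) := (tpure_bilinear (A ⊗ A)%type A).1 w.
  move: x; apply: eq_tens => [||u v].
  - exact: linear_mcomp lL lw.
  - exact: linear_mcomp lR lw.
  by rewrite tens_assocE /m3 (tens_mapE _ _ lp lpp) (tens_mapE _ _ lpp lp)
    !(tens_mapE _ _ lp lp) tens_assocE.
by rewrite eL eA coassoc eR.
Qed.

Fact counit_bilinear_l (C : algType k) (e : C -> k^o) : linear e ->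
  bilinear_map (fun x y : C => (e x : k) *: y).
Proof.
move=> le; split=> [v a u u'|u a v v'].
  by rewrite le scalerDl -scalerA.
by rewrite scalerDr !scalerA mulrC.
Qed.

Fact counit_bilinear_r (C : algType k) (e : C -> k^o) : linear e ->
  bilinear_map (fun x y : C => (e y : k) *: x).
Proof.
by move=> le; have [h1 h2] := counit_bilinear_l le; split=> [v|u] a x y;
  [apply: h2|apply: h1].
Qed.

Fact quot_counit_l q :
  tens_lift (fun x y => (quot_counit x : k) *: y) (quot_comul q) = q.
Proof.
case: (alg_pi_surj q) => a <-; rewrite quot_comulE -{2}(counit_l B a).
have bQ := counit_bilinear_l quot_counit_linear.
have bA := counit_bilinear_l counit_linear.
move: (comul B a); apply: eq_tens => [||u v].
- exact: linear_mcomp (tens_lift_linear bQ) lpp.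
- exact: linear_mcomp pi_linear (tens_lift_linear bA).
rewrite (tens_mapE _ _ pi_linear pi_linear) (tens_liftE bQ) (tens_liftE bA).
by rewrite quot_counitE alg_piZ.
Qed.

Fact quot_counit_r q :
  tens_lift (fun x y => (quot_counit y : k) *: x) (quot_comul q) = q.
Proof.
case: (alg_pi_surj q) => a <-; rewrite quot_comulE -{2}(counit_r B a).
have bQ := counit_bilinear_r quot_counit_linear.
have bA := counit_bilinear_r counit_linear.
move: (comul B a); apply: eq_tens => [||u v].
- exact: linear_mcomp (tens_lift_linear bQ) lpp.
- exact: linear_mcomp pi_linear (tens_lift_linear bA).
rewrite (tens_mapE _ _ pi_linear pi_linear) (tens_liftE bQ) (tens_liftE bA).
by rewrite quot_counitE alg_piZ.
Qed.

Definition quot_bialgebra : bialgebra Q :=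
  @Bialgebra k Q quot_comul quot_counit quot_comul_monoid quot_coassoc
    quot_counit_l quot_counit_r.

End QuotientBialgebra.

Section FreeAlgebra.
Variables (k : fieldType) (G : choiceType).
Local Notation M := {malg k[{fmonom G}]}.

(* The monoid algebra over k of the free monoid on G. *)
Definition free_alg : Type := M.
Local Notation F := free_alg.
HB.instance Definition _ := Choice.on F.

Definition free_add : F -> F -> F := locked_with op_key (@GRing.add M).
Definition free_opp : F -> F := locked_with op_key (@GRing.opp M).
Definition free_zero : F := locked_with op_key (0 : M).
Definition free_scale : k -> F -> F := locked_with op_key (@GRing.scale k M).
Definition free_one : F := locked_with op_key (1 : M).
Definition free_mul : F -> F -> F := locked_with op_key (@GRing.mul M).

Let E := (locked_withE op_key (@GRing.add M),
  locked_withE op_key (@GRing.opp M), locked_withE op_key (0 : M),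
  locked_withE op_key (@GRing.scale k M), locked_withE op_key (1 : M),
  locked_withE op_key (@GRing.mul M)).

Fact free_addA : associative free_add.
Proof. by rewrite /free_add E; apply: addrA. Qed.
Fact free_addC : commutative free_add.
Proof. by rewrite /free_add E; apply: addrC. Qed.
Fact free_add0 : left_id free_zero free_add.
Proof. by rewrite /free_add /free_zero !E; apply: add0r. Qed.
Fact free_addN : left_inverse free_zero free_opp free_add.
Proof. by rewrite /free_add /free_zero /free_opp !E; apply: addNr. Qed.

HB.instance Definition _ :=
  GRing.isZmodule.Build F free_addA free_addC free_add0 free_addN.

Fact free_scaleA a b x :
  free_scale a (free_scale b x) = free_scale (a * b) x.
Proof. by rewrite /free_scale E; apply: scalerA. Qed.
Fact free_scale1 : left_id 1 free_scale.
Proof. by rewrite /free_scale E; apply: scale1r. Qed.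
Fact free_scaleDr : right_distributive free_scale +%R.
Proof.
by rewrite /GRing.add /= /free_add /free_scale !E; apply: scalerDr.
Qed.
Fact free_scaleDl x : {morph free_scale^~ x : a b / a + b}.
Proof.
move=> a b; rewrite [RHS]/GRing.add /= /free_add /free_scale !E.
exact: scalerDl.
Qed.

HB.instance Definition _ := GRing.Zmodule_isLmodule.Build k F
  free_scaleA free_scale1 free_scaleDr free_scaleDl.

Fact free_mulA : associative free_mul.
Proof. by rewrite /free_mul E; apply: mulrA. Qed.
Fact free_mul1l : left_id free_one free_mul.
Proof. by rewrite /free_mul /free_one !E; apply: mul1r. Qed.
Fact free_mul1r : right_id free_one free_mul.
Proof. by rewrite /free_mul /free_one !E; apply: mulr1. Qed.
Fact free_mulDl : left_distributive free_mul +%R.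
Proof. by rewrite /GRing.add /= /free_add /free_mul !E; apply: mulrDl. Qed.
Fact free_mulDr : right_distributive free_mul +%R.
Proof. by rewrite /GRing.add /= /free_add /free_mul !E; apply: mulrDr. Qed.
Fact free_one_neq0 : free_one != 0.
Proof. by rewrite /GRing.zero /= /free_one /free_zero !E; apply: oner_neq0. Qed.

HB.instance Definition _ := GRing.Zmodule_isNzRing.Build F
  free_mulA free_mul1l free_mul1r free_mulDl free_mulDr free_one_neq0.

Definition free_gen (g : G) : F := << fmu g >> : M.

Definition free_mon (m : {fmonom G}) : F := << m >> : M.

Fact free_monM m n : free_mon m * free_mon n = free_mon (mmul m n).
Proof.
rewrite [LHS]/GRing.mul /= /free_mul E malgM_def fgmulUU mulr1.
by [].
Qed.

Fact free_monZ (c : k) m : << c *g m >> = c *: (<< m >> : M).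
Proof.
by apply/malgP => i; rewrite [RHS]mcoeffZ [LHS]mcoeffU (mcoeffU m 1) mulr_natr.
Qed.

Fact free_combE (a : k) (x y : F) : a *: x + y = a *: (x : M) + (y : M) :> M.
Proof.
by rewrite [LHS]/GRing.add [in LHS]/GRing.scale /= /free_add /free_scale !E.
Qed.

Fact free_span (S : F -> Prop) :
  S 0 -> (forall x y, S x -> S y -> S (x + y)) ->
  (forall c m, S (c *: free_mon m)) -> forall x, S x.
Proof.
rewrite /GRing.zero /GRing.add /GRing.scale /= /free_zero /free_add /free_scale.
rewrite !E => S0 SD SU; apply: malg_span => // c m.
by rewrite free_monZ; apply: SU.
Qed.

Fact free_scaleAl (a : k) (x y : F) : a *: (x * y) = a *: x * y.
Proof.
rewrite /GRing.mul /GRing.scale /= /free_mul /free_scale !E.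
exact: scalerAl.
Qed.

HB.instance Definition _ := GRing.Lmodule_isLalgebra.Build k F free_scaleAl.

Fact free_mon_scaleAr (a : k) m n :
  a *: (free_mon m * free_mon n) = free_mon m * (a *: free_mon n).
Proof.
rewrite [in RHS]/GRing.mul [in RHS]/GRing.scale /= free_monM.
rewrite [in LHS]/GRing.scale /= /free_mul /free_scale !E /free_mon.
by rewrite -!free_monZ malgM_def fgmulUU mul1r.
Qed.

Fact free_scaleAr (a : k) (x y : F) : a *: (x * y) = x * (a *: y).
Proof.
elim/free_span: x => [|x x' hx hx'|c m]; first by rewrite !mul0r scaler0.
  by rewrite !mulrDl scalerDr hx hx'.
elim/free_span: y => [|y y' hy hy'|d n].
- by rewrite scaler0 !mulr0 scaler0.
- by rewrite scalerDr !mulrDr scalerDr hy hy'.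
by rewrite -!scalerAl scalerA [RHS]/=
  scalerA -!free_mon_scaleAr !scalerA mulrCA mulrA.
Qed.

HB.instance Definition _ := GRing.Lalgebra_isAlgebra.Build k F free_scaleAr.

Section Lift.
Variables (B : algType k) (h : G -> B).

Definition free_lift : F -> B :=
  locked_with op_key (malg_ext (fun m : {fmonom G} => \prod_(g <- m) h g)).

Fact free_lift_linear : linear free_lift.
Proof.
rewrite /free_lift locked_withE => a x y; rewrite free_combE.
exact: malg_ext_linear.
Qed.

HB.instance Definition _ :=
  GRing.isLinear.Build k F B _ free_lift free_lift_linear.

Fact free_lift_mon m : free_lift (free_mon m) = \prod_(g <- m) h g.
Proof. by rewrite /free_lift locked_withE malg_extU scale1r. Qed.

Lemma free_lift_gen g : free_lift (free_gen g) = h g.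
Proof. by rewrite free_lift_mon fmU big_seq1. Qed.

Fact free_lift_monoid : monoid_morphism free_lift.
Proof.
split=> [|x y].
  rewrite [1]/GRing.one /= /free_one locked_withE.
  by rewrite free_lift_mon fm1 big_nil.
elim/free_span: x => [|x x' hx hx'|c m]; first by rewrite mul0r linear0 mul0r.
  by rewrite mulrDl !linearD /= hx hx' mulrDl.
elim/free_span: y => [|y y' hy hy'|d n].
- by rewrite mulr0 linear0 mulr0.
- by rewrite mulrDr !linearD /= hy hy' mulrDr.
rewrite -scalerAl -scalerAr free_monM !linearZ /= !free_lift_mon fmM big_cat /=.
by rewrite -scalerAl -scalerAr.
Qed.

HB.instance Definition _ :=
  GRing.isMonoidMorphism.Build F B free_lift free_lift_monoid.

End Lift.

End FreeAlgebra.

Lemma ideal_lift_vanish (k : fieldType) (A B : algType k)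
    (f : {lrmorphism A -> B}) (S : A -> Prop) :
  (forall x, S x -> f x = 0) -> forall x, in_ideal S x -> f x = 0.
Proof.
move=> fS x; elim=> [|{}x /fS //|{}x y _ fx _ fy|a {}x _ fx|{}x a _ fx].
- exact: linear0.
- by rewrite linearD /= fx fy addr0.
- by rewrite rmorphM /= fx mulr0.
- by rewrite rmorphM /= fx mul0r.
Qed.

Lemma proper_of_lift (k : fieldType) (A B : algType k)
    (f : {lrmorphism A -> B}) (S : A -> Prop) :
  (forall x, S x -> f x = 0) -> ~ in_ideal S 1.
Proof.
move=> fS /(ideal_lift_vanish fS) /eqP.
by rewrite rmorph1 oner_eq0.
Qed.

Section QuotientAlgebraLift.
Variables (k : fieldType) (A B : algType k) (I : ideal A).
Variable f : {lrmorphism A -> B}.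

Definition alg_lift (f0 : forall x, I x -> f x = 0) : quot_alg I -> B :=
  quot_lift f.

Variable f0 : forall x, I x -> f x = 0.

Fact lrmorph_linear : linear f. Proof. exact: linearP. Qed.

Lemma alg_liftE x : alg_lift f0 (alg_pi I x) = f x.
Proof. by apply: quot_liftE => //; apply: lrmorph_linear. Qed.

Fact alg_lift_linear : linear (alg_lift f0).
Proof. exact: quot_lift_linear lrmorph_linear f0. Qed.

HB.instance Definition _ :=
  GRing.isLinear.Build k (quot_alg I) B _ (alg_lift f0) alg_lift_linear.

Fact alg_lift_monoid : monoid_morphism (alg_lift f0).
Proof.
split=> [|x y]; first by rewrite -(rmorph1 (alg_pi I)) alg_liftE rmorph1.
case: (alg_pi_surj x) (alg_pi_surj y) => a <- [b <-].
by rewrite -(rmorphM (alg_pi I)) !alg_liftE rmorphM.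
Qed.

HB.instance Definition _ := GRing.isMonoidMorphism.Build (quot_alg I) B
  (alg_lift f0) alg_lift_monoid.

End QuotientAlgebraLift.

Definition presented_alg (k : fieldType) (G : choiceType)
    (R : free_alg k G -> Prop) (R1 : ~ in_ideal R 1) : algType k :=
  quot_alg (gen_ideal R1).

Definition presented_gen (k : fieldType) (G : choiceType)
    (R : free_alg k G -> Prop) (R1 : ~ in_ideal R 1) (g : G) :
    presented_alg R1 :=
  alg_pi (gen_ideal R1) (free_gen k g).

Inductive in_subalg (k : fieldType) (A : algType k) (S : A -> Prop) :
    A -> Prop :=
| subalg_mem x : S x -> in_subalg S x
| subalg1 : in_subalg S 1
| subalgD x y : in_subalg S x -> in_subalg S y -> in_subalg S (x + y)
| subalgM x y : in_subalg S x -> in_subalg S y -> in_subalg S (x * y)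
| subalgZ (a : k) x : in_subalg S x -> in_subalg S (a *: x).

Definition lie (R : pzRingType) (a b : R) : R := a * b - b * a.

(* [genT i] stands for the generator t_(i+1), so that the family t_n is
   indexed by n >= 1; see [free_t] and [cm_t]. *)
Inductive cm_gen := genX | genY | genT of nat.

Definition cm_gen_code (g : cm_gen) : option (option nat) :=
  match g with genX => None | genY => Some None | genT i => Some (Some i) end.
Definition cm_gen_decode (c : option (option nat)) : cm_gen :=
  match c with None => genX | Some None => genY | Some (Some i) => genT i end.
Lemma cm_gen_codeK : cancel cm_gen_code cm_gen_decode.
Proof. by case. Qed.
HB.instance Definition _ := Choice.copy cm_gen (can_type cm_gen_codeK).

Inductive heis_gen := heisX | heisY | heisT.

Definition heis_gen_code (g : heis_gen) : option bool :=
  match g with heisX => None | heisY => Some true | heisT => Some false end.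
Definition heis_gen_decode (c : option bool) : heis_gen :=
  match c with
  | None => heisX | Some true => heisY | Some false => heisT
  end.
Lemma heis_gen_codeK : cancel heis_gen_code heis_gen_decode.
Proof. by case. Qed.
HB.instance Definition _ := Choice.copy heis_gen (can_type heis_gen_codeK).

Section ConnesMoscovici.
Variables (k : fieldType) (lam : k).

Local Notation fX := (free_gen k genX).
Local Notation fY := (free_gen k genY).

(* t_n, for n >= 1 (at n = 0 it is the junk value t_1). *)
Definition free_t (n : nat) : free_alg k cm_gen := free_gen k (genT n.-1).

Inductive cm_rel : free_alg k cm_gen -> Prop :=
| cm_t1 : cm_rel (free_t 1 - 1)
| cm_tt m n : (1 <= m)%N -> (1 <= n)%N -> cm_rel (lie (free_t m) (free_t n))
| cm_YX : cm_rel (lie fY fX - lam *: fX)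
| cm_Yt n : (1 <= n)%N ->
    cm_rel (lie fY (free_t n) - (lam * n.-1%:R) *: free_t n)
| cm_Xt n : (1 <= n)%N ->
    cm_rel (lie fX (free_t n)
      - lam *: (n.+1%:R *: free_t n.+1 - 2%:R *: (free_t 2 * free_t n))).

Definition cm_eps_gen (g : cm_gen) : k^o :=
  match g with genX => 0 | genY => 0 | genT i => (i == 0)%:R end.

Fact cm_eps_vanish x : cm_rel x -> free_lift cm_eps_gen x = 0.
Proof.
have eX : free_lift cm_eps_gen fX = 0 by rewrite free_lift_gen.
have eY : free_lift cm_eps_gen fY = 0 by rewrite free_lift_gen.
have eT n : free_lift cm_eps_gen (free_t n) = (n.-1 == 0)%:R.
  by rewrite free_lift_gen.
have eL a b : free_lift cm_eps_gen (lie a b) = 0.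
  by rewrite /lie rmorphB !rmorphM /= [X in _ - X]mulrC subrr.
have eB a b : free_lift cm_eps_gen (a - b)
    = free_lift cm_eps_gen a - free_lift cm_eps_gen b by exact: rmorphB.
have eZ c a : free_lift cm_eps_gen (c *: a) = c * free_lift cm_eps_gen a.
  exact: linearZ.
case=> [|m n _ _||n n1|n n1]; rewrite ?eL // eB ?eZ ?eL.
- have e1 : free_lift cm_eps_gen 1 = 1 by exact: rmorph1.
  by rewrite e1 eT; apply: subrr.
- by rewrite eX mulr0 subr0.
- by case: n n1 => [|[|n]] // _; rewrite eT ?mulr0 ?mul0r subr0.
- by case: n n1 => // n _; rewrite eB !eZ rmorphM /= !eT mul0r !mulr0 subr0 mulr0 subr0.
Qed.

Definition cm_proper : ~ in_ideal cm_rel 1 :=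
  proper_of_lift cm_eps_vanish.

Definition HCM : algType k := presented_alg cm_proper.
Definition cm_X : HCM := presented_gen cm_proper genX.
Definition cm_Y : HCM := presented_gen cm_proper genY.
Definition cm_t (n : nat) : HCM := presented_gen cm_proper (genT n.-1).

(* The coproduct of t_n; the inner sum is over all (i_1, ..., i_k) with
   i_j >= 1 and i_1 + ... + i_k = n. *)
Definition cm_comul_t (n : nat) : HCM ⊗ HCM :=
  \sum_(1 <= m < n.+1)
    cm_t m ⊗ \sum_(i : {ffun 'I_m -> 'I_n.+1} |
                  [forall j, (1 <= i j)%N] && (\sum_j i j == n)%N)
               \prod_(j < m) cm_t (i j).

(* Multiplicativity of the coproduct and of the counit makes these values
   determine the whole Hopf algebra structure. *)
Definition is_cm_hopf (H : hopf_algebra HCM) : Prop :=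
  [/\ [/\ comul H cm_X = cm_X ⊗ 1 + 1 ⊗ cm_X + cm_Y ⊗ (2%:R *: cm_t 2),
          comul H cm_Y = cm_Y ⊗ 1 + 1 ⊗ cm_Y
        & forall n, (1 <= n)%N -> comul H (cm_t n) = cm_comul_t n],
      [/\ counit H cm_X = 0, counit H cm_Y = 0
        & forall n, (1 <= n)%N -> counit H (cm_t n) = (n == 1%N)%:R]
    & antipode H cm_X = - cm_X + 2%:R *: (cm_Y * cm_t 2)
      /\ antipode H cm_Y = - cm_Y].

Definition heis_ideal_gen (x : HCM) : Prop :=
  exists2 n, (3 <= n)%N & x = cm_t n - cm_t 2 ^+ n.-1.

Fact cm_eps_ideal x : gen_ideal cm_proper x -> free_lift cm_eps_gen x = 0.
Proof. exact: ideal_lift_vanish cm_eps_vanish x. Qed.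

Definition cm_eps : HCM -> k^o := alg_lift cm_eps_ideal.
HB.instance Definition _ := GRing.LRMorphism.on cm_eps.

Lemma cm_epsE g : cm_eps (presented_gen cm_proper g) = cm_eps_gen g.
Proof. by rewrite /cm_eps alg_liftE; apply: free_lift_gen. Qed.

Fact heis_eps_vanish x : heis_ideal_gen x -> cm_eps x = 0.
Proof.
move=> [[|[|[|n]]] // _ ->].
by rewrite rmorphB rmorphXn /= !cm_epsE expr0n subrr.
Qed.

Definition heis_proper : ~ in_ideal heis_ideal_gen 1 :=
  proper_of_lift heis_eps_vanish.

Definition heis_ideal : ideal HCM := gen_ideal heis_proper.

Definition heis : algType k := quot_alg heis_ideal.

Definition heis_X : heis := alg_pi heis_ideal cm_X.
Definition heis_Y : heis := alg_pi heis_ideal cm_Y.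
Definition heis_t : heis := 2%:R *: alg_pi heis_ideal (cm_t 2).

Local Notation hX := (free_gen k heisX).
Local Notation hY := (free_gen k heisY).
Local Notation ht := (free_gen k heisT).

Inductive heis_rel : free_alg k heis_gen -> Prop :=
| heis_YX : heis_rel (lie hY hX - lam *: hX)
| heis_Xt : heis_rel (lie hX ht - (2%:R^-1 * lam) *: ht ^+ 2)
| heis_Yt : heis_rel (lie hY ht - lam *: ht).

Fact heis_rel_vanish x :
  heis_rel x -> free_lift (fun _ : heis_gen => 0 : k^o) x = 0.
Proof.
set h := fun _ => _.
have eg g : free_lift h (free_gen k g) = 0 by rewrite free_lift_gen.
have eB a b : free_lift h (a - b) = free_lift h a - free_lift h b.
  exact: rmorphB.
have eM a b : free_lift h (a * b) = free_lift h a * free_lift h b.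
  exact: rmorphM.
have eZ c a : free_lift h (c *: a) = c * free_lift h a by exact: linearZ.
by case; rewrite /lie !eB eZ ?expr2 !eM !eg !mulr0 !subr0.
Qed.

Definition heis_rel_proper : ~ in_ideal heis_rel 1 :=
  proper_of_lift heis_rel_vanish.

End ConnesMoscovici.

Arguments cm_proper {k} lam _.
Arguments heis_proper {k} lam _.
Arguments heis_rel_proper {k} lam _.

(* Main.v *)
Require Import Defs.
From HB Require Import structures.
From mathcomp Require Import all_boot all_order all_algebra.
From mathcomp.multinomials Require Import monalg.

Set Implicit Arguments.
Unset Strict Implicit.
Unset Printing Implicit Defensive.

Import GRing.Theory.
Local Open Scope ring_scope.

(** Modulo the ideal, t_n becomes u^(n-1) for u = t_2, and since there are
C(n-1, m-1) compositions of n into m parts, the coproduct of t_n becomes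
(u ⊗ 1 + 1 ⊗ u)^(n-1), the power of the image of the coproduct of t_2: this
gives the biideal property. The relations of the Connes-Moscovici algebra
hold for X, Y and t_n := (t/2)^(n-1) in every algebra in which X, Y, t satisfy
the three Heisenberg relations, so the quotient has the universal property of
this presentation. Applied to the converse algebra, it yields the antipode as
an anti-morphism; the antipode axioms are stable under products, hence need
only be checked on X, Y and t. *)

(** * The converse algebra, target of anti-morphisms *)

Section ConverseAlgebra.
Variables (k : fieldType) (A : algType k).

(** The scalar action of [A] is kept, so that an anti-endomorphism of [A] becomes a morphism
    [{lrmorphism A -> A^c}]. Reversing the product exchanges the two compatibilities of scaling with
    multiplication. *)
HB.instance Definition _ := GRing.Zmodule_isLmodule.Build k A^c
  (@scalerA k A) (@scale1r k A) (@scalerDr k A) (@scalerDl k A).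

Fact conv_scaleAl (a : k) (x y : A^c) : a *: (x * y) = a *: x * y.
Proof. exact: (@scalerAr k A). Qed.
HB.instance Definition _ := GRing.Lmodule_isLalgebra.Build k A^c conv_scaleAl.

Fact conv_scaleAr (a : k) (x y : A^c) : a *: (x * y) = x * (a *: y).
Proof. exact: (@scalerAl k A). Qed.
HB.instance Definition _ := GRing.Lalgebra_isAlgebra.Build k A^c conv_scaleAr.

End ConverseAlgebra.

Lemma alg_pi_eq0 (k : fieldType) (A : algType k) (I : ideal A) x :
  I x -> alg_pi I x = 0.
Proof. by move=> Ix; rewrite -(linear0 (alg_pi I)); apply/alg_piP; rewrite subr0. Qed.

(** * Biideals and the kernel of p ⊗ p *)

Section TensorKernel.
Variables (k : fieldType) (A : algType k) (I : ideal A).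
Local Notation p := (alg_pi I).

(* A linear section of p ⊗ p modulo A ⊗ I + I ⊗ A shows that this span is the
   whole kernel. *)
Lemma tens_map_pi_ker (z : A ⊗ A) : tens_map p p z = 0 ->
  lspan (fun z => exists a b, (I a \/ I b) /\ z = a ⊗ b) z.
Proof.
set J := lspan _ => pz0.
(* Representatives are not chosen linearly, but another choice moves the tensor by an element of
   [J]; hence [phi] is bilinear. *)
pose phi (a b : quot_alg I) := quot_pi J (quot_repr a ⊗ quot_repr b).
have phiE a b : phi (p a) (p b) = quot_pi J (a ⊗ b).
  have lpl := (tpure_bilinear A A).1; have lpr := (tpure_bilinear A A).2.
  apply/quot_piP; set a' := quot_repr _; set b' := quot_repr _.
  have -> : a' ⊗ b' - a ⊗ b = (a' - a) ⊗ b' + a ⊗ (b' - b).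
    have -> : a' - a = (-1) *: a + a' by rewrite scaleN1r addrC.
    have -> : b' - b = (-1) *: b + b' by rewrite scaleN1r addrC.
    rewrite lpl lpr !scaleN1r [- (a ⊗ b') + _]addrC [- (a ⊗ b) + _]addrC.
    by rewrite addrA subrK.
  by apply: spanD; apply: span_mem; do 2!eexists; split;
     [left; apply: quot_repr_pi|by []|right; apply: quot_repr_pi|by []].
have bphi : bilinear_map phi.
  split=> [b c a a'|a c b b'].
    case: (alg_pi_surj a) (alg_pi_surj a') (alg_pi_surj b).
    move=> {}a <- [{}a' <-] [{}b <-]; rewrite -linearP !phiE.
    by rewrite (tpure_bilinear A A).1 linearP.
  case: (alg_pi_surj a) (alg_pi_surj b) (alg_pi_surj b').
  move=> {}a <- [{}b <-] [{}b' <-]; rewrite -linearP !phiE.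
  by rewrite (tpure_bilinear A A).2 linearP.
have lp := @pi_linear k A I.
(* The projection modulo [J] factors through p ⊗ p, so it vanishes wherever p ⊗ p does. *)
have lift_phi : (fun y => tens_lift phi (tens_map p p y)) =1 quot_pi J.
  apply: eq_tens => [||a b].
  - exact: linear_mcomp (tens_lift_linear bphi) (tens_map_linear lp lp).
  - exact: linearP.
  by rewrite (tens_mapE _ _ lp lp) (tens_liftE bphi) phiE.
have /esym := lift_phi z.
rewrite /= pz0 (linear_map0 (tens_lift_linear bphi)) -(linear0 (quot_pi J)).
by move=> /quot_piP; rewrite subr0.
Qed.

End TensorKernel.

(** The composite of the coproduct with p ⊗ p is linear and multiplicative, so its zeros form a
    two-sided ideal; [tens_map_pi_ker] turns vanishing into membership in A ⊗ I + I ⊗ A. *)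
Lemma biideal_gen (k : fieldType) (A : algType k) (B : bialgebra A)
    (S : A -> Prop) (S1 : ~ in_ideal S 1) :
    let p := alg_pi (gen_ideal S1) in
  (forall x, S x -> tens_map p p (comul B x) = 0) ->
  (forall x, S x -> (counit B x : k) = 0) -> biideal B (gen_ideal S1).
Proof.
move=> p cS eS; split; last exact: (@ideal_lift_vanish k A _ (counit B) S eS).
move=> x Ix; apply: tens_map_pi_ker.
have [_ cM] := comul_monoid B.
have [_ pM] := @tens_map_pi_monoid k A (gen_ideal S1).
have lpp := tens_map_linear (@pi_linear k A (gen_ideal S1)) (@pi_linear k A (gen_ideal S1)).
elim: Ix => [|y /cS //|y z _ hy _ hz|a y _ hy|y a _ hy].
- by rewrite linear0 (linear_map0 lpp).
- rewrite linearD -[comul B y]scale1r lpp.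
  by move: hy hz; rewrite /p => -> ->; rewrite scale1r addr0.
- by move: hy; rewrite cM pM /p => ->; rewrite mulr0.
- by move: hy; rewrite cM pM /p => ->; rewrite mul0r.
Qed.

(** * Checking the antipode axioms on generators *)

Section AntipodeFromGenerators.
Variables (k : fieldType) (A : algType k) (B : bialgebra A) (S : A -> A).
Hypotheses (lS : linear S) (S1 : S 1 = 1).
Hypothesis SM : forall x y, S (x * y) = S y * S x.

(** Composed with the coproduct, these two maps are the convolution products of [S] with the
    identity, on either side. *)
Definition conv_l := tens_lift (fun x y : A => S x * y).
Definition conv_r := tens_lift (fun x y : A => x * S y).

Fact conv_l_bilinear : bilinear_map (fun x y : A => S x * y).
Proof.
split=> [v a u u'|u a v v']; first by rewrite lS mulrDl scalerAl.
by rewrite mulrDr scalerAr.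
Qed.

Fact conv_r_bilinear : bilinear_map (fun x y : A => x * S y).
Proof.
split=> [v a u u'|u a v v']; first by rewrite mulrDl scalerAl.
by rewrite lS mulrDr scalerAr.
Qed.

Let lL := tens_lift_linear conv_l_bilinear.
Let lR := tens_lift_linear conv_r_bilinear.

HB.instance Definition _ :=
  GRing.isLinear.Build k (A ⊗ A)%type A _ conv_l lL.
HB.instance Definition _ :=
  GRing.isLinear.Build k (A ⊗ A)%type A _ conv_r lR.

Lemma conv_lE x y : conv_l (x ⊗ y) = S x * y.
Proof. exact: tens_liftE conv_l_bilinear _ _. Qed.

Lemma conv_rE x y : conv_r (x ⊗ y) = x * S y.
Proof. exact: tens_liftE conv_r_bilinear _ _. Qed.

(** Anti-multiplicativity of [S] puts [S b] outermost and leaves the value at [z] intact in the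
    middle. *)
Fact conv_lM z b b' : conv_l (z * (b ⊗ b')) = S b * conv_l z * b'.
Proof.
elim/tens_ind: z => [|z z' hz hz'|a a'].
- by rewrite mul0r linear0 mulr0 mul0r.
- by rewrite mulrDl !linearD /= hz hz' mulrDr mulrDl.
by rewrite tpureM !conv_lE SM !mulrA.
Qed.

Fact conv_rM a a' z : conv_r ((a ⊗ a') * z) = a * conv_r z * S a'.
Proof.
elim/tens_ind: z => [|z z' hz hz'|b b'].
- by rewrite mulr0 linear0 mulr0 mul0r.
- by rewrite mulrDr !linearD /= hz hz' mulrDr mulrDl.
by rewrite tpureM !conv_rE SM !mulrA.
Qed.

Definition antipode_at a := conv_l (comul B a) = (counit B a : k) *: 1
  /\ conv_r (comul B a) = (counit B a : k) *: 1.

(** For a product [x * y], the middle factor in [conv_lM] is the scalar ε(x); it moves out and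
    leaves the value for [y]. In [conv_rM] the roles are exchanged: the scalar ε(y) moves out. *)
Lemma antipode_at_subalg (G : A -> Prop) :
  (forall a, G a -> antipode_at a) -> forall a, in_subalg G a -> antipode_at a.
Proof.
move=> hG a; have [c1 cM] := comul_monoid B.
elim=> {a} [a /hG //| |x y _ [xl xr] _ [yl yr]|x y _ [xl xr] _ [yl yr]|c x _ [xl xr]].
- by split; rewrite c1 rmorph1 -tpure1 ?conv_lE ?conv_rE S1 mul1r scale1r.
- by split; rewrite !linearD /= ?(xl, xr) ?(yl, yr) -scalerDl.
- split; rewrite cM rmorphM /=.
    (* Stated for arbitrary [z], to allow induction down to pure tensors. *)
    have Hz z : conv_l (comul B x * z) = (counit B x : k) *: conv_l z.
      elim/tens_ind: z => [|z z' hz hz'|b b'].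
      - by rewrite mulr0 linear0 scaler0.
      - by rewrite mulrDr !linearD /= hz hz'.
      by rewrite conv_lM xl conv_lE -scalerAr mulr1 scalerAl.
    by rewrite Hz yl scalerA.
  have Hz z : conv_r (z * comul B y) = (counit B y : k) *: conv_r z.
    elim/tens_ind: z => [|z z' hz hz'|b b'].
    - by rewrite mul0r linear0 scaler0.
    - by rewrite mulrDl !linearD /= hz hz'.
    by rewrite conv_rM yr conv_rE -scalerAr mulr1 scalerAl.
  by rewrite Hz xr scalerA mulrC.
- by split; rewrite !linearZ /= ?(xl, xr) scalerA.
Qed.

Lemma antipode_at_primitive a :
  comul B a = a ⊗ 1 + 1 ⊗ a -> (counit B a : k) = 0 -> S a = - a ->
  antipode_at a.
Proof.
move=> ca ea Sa; rewrite /antipode_at ca ea scale0r.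
have [cD dD] : {morph conv_l : x y / x + y} /\ {morph conv_r : x y / x + y}.
  by split=> x y; rewrite linearD.
rewrite cD dD !conv_lE !conv_rE S1 Sa !mul1r !mulr1.
by rewrite addNr subrr.
Qed.

(** The term [b * c] of [S a] cancels against [S b * c] on one side and against [b * S c] on the
    other. *)
Lemma antipode_at_skew_primitive a b c :
  comul B a = 1 ⊗ a + a ⊗ 1 + b ⊗ c -> (counit B a : k) = 0 ->
  S a = - a + b * c -> S b = - b -> S c = - c -> antipode_at a.
Proof.
move=> ca ea Sa Sb Sc; rewrite /antipode_at ca ea scale0r.
have [cD dD] : {morph conv_l : x y / x + y} /\ {morph conv_r : x y / x + y}.
  by split=> x y; rewrite linearD.
rewrite !cD !dD !conv_lE !conv_rE S1 Sa Sb Sc !mul1r !mulr1 mulNr mulrN.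
by split; [rewrite addNKr subrr|rewrite [- a + _]addrC subrK subrr].
Qed.

Lemma hopf_from_generators (G : A -> Prop) :
  (forall a, in_subalg G a) -> (forall a, G a -> antipode_at a) ->
  exists2 K : hopf_algebra A, hopf_bialgebra K = B & antipode K =1 S.
Proof.
move=> gen hG; have hS a := antipode_at_subalg hG (gen a).
pose SL : {linear A -> A} := HB.pack S (GRing.isLinear.Build k A A _ S lS).
by exists (@HopfAlgebra k A B SL (fun a => (hS a).1) (fun a => (hS a).2)).
Qed.

End AntipodeFromGenerators.

(** * Compositions and powers of primitive sums *)

(** Lowering every part by 1 gives the (m+1)-tuples of naturals with sum r, which
    [card_ord_partitions] counts. *)
Lemma card_compositions m r :
  #|[set i : {ffun 'I_m.+1 -> 'I_(m.+1 + r).+1} |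
      [forall j, (1 <= i j)%N] && (\sum_j i j == m.+1 + r)%N]| = 'C(m + r, m).
Proof.
rewrite -card_ord_partitions.
pose f (t : m.+1.-tuple 'I_r.+1) : {ffun 'I_m.+1 -> 'I_(m.+1 + r).+1} :=
  [ffun j => inord (tnth t j).+1].
have fE t j : f t j = (tnth t j).+1 :> nat.
  by rewrite ffunE inordK // ltnS -addn1 addnC leq_add // leq_ord.
have f_inj : injective f.
  by move=> t t' e; apply: eq_from_tnth => j; apply/val_inj/succn_inj; rewrite -!fE e.
rewrite -(card_imset _ f_inj); apply: eq_card => i; rewrite inE.
have sumS (t : m.+1.-tuple 'I_r.+1) :
    (\sum_j f t j = m.+1 + \sum_(x <- t) x)%N.
  rewrite big_tuple (eq_bigr _ (fun j _ => fE t j)).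
  under eq_bigr do rewrite -addn1.
  by rewrite big_split /= sum1_card card_ord addnC.
apply/andP/imsetP => [[/forallP i1 /eqP si]|[t]].
  pose t : m.+1.-tuple 'I_r.+1 := [tuple inord (i j).-1 | j < m.+1].
  have ft : f t = i.
    apply/ffunP => j; apply/val_inj; rewrite [LHS]fE tnth_mktuple inordK.
      by rewrite prednK.
    (* The other [m] parts are at least 1, so [i j] is at most [r + 1] and [inord] does not fall
       back to its default. *)
    have : (i j + m <= \sum_l i l)%N.
      rewrite (bigD1 j) //= leq_add2l -[X in (X <= _)%N]/(m.+1.-1).
      rewrite -[X in (X.-1 <= _)%N]card_ord -(cardC1 j) -sum1_card.
      by apply: leq_sum => l _.
    move=> /leq_trans /(_ (eq_leq si)).
    by rewrite -{1}(prednK (i1 j)) !addSn !ltnS addnC leq_add2l.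
  exists t => //; rewrite inE; have /esym/eqP := sumS t.
  by rewrite ft [X in _ == X]si eqn_add2l.
rewrite inE => /eqP st ->; split; last first.
  by apply/eqP; rewrite sumS st.
by apply/forallP => j; rewrite fE.
Qed.

Section TensorPowers.
Variables (k : fieldType) (A B : algType k).

Lemma tpure_exprl (a : A) n : (a ⊗ (1 : B)) ^+ n = (a ^+ n) ⊗ 1.
Proof. by elim: n => [|n IH]; rewrite ?expr0 ?tpure1 // !exprS IH tpureM mulr1. Qed.

Lemma tpure_exprr (b : B) n : ((1 : A) ⊗ b) ^+ n = 1 ⊗ (b ^+ n).
Proof. by elim: n => [|n IH]; rewrite ?expr0 ?tpure1 // !exprS IH tpureM mulr1. Qed.

Lemma tpure_mulrn (a : A) (b : B) n : a ⊗ (b *+ n) = (a ⊗ b) *+ n.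
Proof.
elim: n => [|n IH]; first exact: (linear_map0 ((tpure_bilinear _ _).2 _)).
have := (tpure_bilinear A B).2 a 1 b (b *+ n).
by rewrite !scale1r IH !mulrS.
Qed.

(** Binomial theorem for the commuting elements a ⊗ 1 and 1 ⊗ b. The coefficient sits in the right
    factor, as the inner sum of [cm_comul_t] does. *)
Lemma expr_primitive (a : A) (b : B) n :
  (a ⊗ 1 + 1 ⊗ b) ^+ n = \sum_(m < n.+1) (a ^+ m) ⊗ (b ^+ (n - m) *+ 'C(n, m)).
Proof.
rewrite addrC exprDn_comm; last by rewrite /GRing.comm !tpureM !mulr1 !mul1r.
apply: eq_bigr => m _.
by rewrite tpure_exprl tpure_exprr tpureM mul1r mulr1 tpure_mulrn.
Qed.

End TensorPowers.

(** * Relations between the generators, and the coproduct of t_n modulo the ideal *)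

Section Heisenberg.
Variables (k : fieldType) (lam : k).
Local Notation p := (alg_pi (heis_ideal lam)).
Local Notation q := (alg_pi (gen_ideal (cm_proper lam))).
Local Notation u := (p (cm_t lam 2)).

Fact cm_rel0 x : cm_rel lam x -> q x = 0.
Proof. by move=> Rx; apply/alg_pi_eq0/ideal_mem. Qed.

Lemma cm_t1E : cm_t lam 1 = 1.
Proof.
apply/eqP; rewrite -subr_eq0; apply/eqP.
by have := cm_rel0 (cm_t1 lam); rewrite linearB rmorph1.
Qed.

Lemma cm_YXE : lie (cm_Y lam) (cm_X lam) = lam *: cm_X lam.
Proof.
apply/eqP; rewrite -subr_eq0; apply/eqP.
have := cm_rel0 (cm_YX lam).
by rewrite linearB linearZ /= /lie linearB !rmorphM.
Qed.

Lemma cm_YtE n : (1 <= n)%N ->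
  lie (cm_Y lam) (cm_t lam n) = (lam * n.-1%:R) *: cm_t lam n.
Proof.
move=> n1; apply/eqP; rewrite -subr_eq0; apply/eqP.
have := cm_rel0 (cm_Yt lam n1).
by rewrite linearB linearZ /= /lie linearB !rmorphM.
Qed.

Lemma cm_XtE n : (1 <= n)%N ->
  lie (cm_X lam) (cm_t lam n)
  = lam *: (n.+1%:R *: cm_t lam n.+1 - 2%:R *: (cm_t lam 2 * cm_t lam n)).
Proof.
move=> n1; apply/eqP; rewrite -subr_eq0; apply/eqP.
have := cm_rel0 (cm_Xt lam n1).
by rewrite linearB linearZ /= /lie !linearB !linearZ /= !rmorphM.
Qed.

(** The ideal gives the case n >= 3; for n = 1 it is the relation t_1 = 1. *)
Lemma heis_tE n : (1 <= n)%N -> p (cm_t lam n) = u ^+ n.-1.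
Proof.
case: n => [|[|[|n]]] // _; first by rewrite cm_t1E rmorph1.
rewrite -rmorphXn; apply/alg_piP/ideal_mem.
by exists n.+3.
Qed.

(** A composition of n into m parts contributes u^(n-m), whatever its parts, so the inner sum is
    this power times the number of compositions, which is the coefficient in [expr_primitive]. *)
Lemma tens_map_comul_t n : (1 <= n)%N ->
  tens_map p p (cm_comul_t lam n) = (u ⊗ 1 + 1 ⊗ u) ^+ n.-1.
Proof.
case: n => // n _ /=.
have lp := @pi_linear k _ (heis_ideal lam).
have lpp := tens_map_linear lp lp.
have ppD : {morph tens_map p p : x y / x + y}.
  by move=> x y; have := lpp 1 x y; rewrite !scale1r.
rewrite (big_morph _ ppD (linear_map0 lpp)).
(* Both indices are now shifted: the compositions are those of [n.+1] into [m.+1] parts. *)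
rewrite expr_primitive big_add1 big_mkord; apply: eq_bigr => -[m /= mn] _.
rewrite (tens_mapE _ _ lp lp) (heis_tE (ltn0Sn m)); congr (_ ⊗ _).
rewrite linear_sum /=.
rewrite (eq_bigr (fun=> u ^+ (n - m))) => [|i /andP[/forallP i1 /eqP si]].
  rewrite sumr_const; congr (_ *+ _).
  rewrite -cardsE; move: (n - m)%N (@subnKC m n mn) => r <-.
  by rewrite -card_compositions; apply: eq_card => i; rewrite !inE.
rewrite rmorph_prod (eq_bigr (fun j => u ^+ (i j).-1)) => [|j _]; last exact: heis_tE.
(* Adding [m.+1], one for each part, restores the sum of the parts and removes the truncated
   subtraction. *)
rewrite -expr_sum; congr (_ ^+ _); apply: (@addnI m.+1).
rewrite [RHS]addSn (@subnKC m n mn) -[RHS]si.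
transitivity (\sum_(j < m.+1) (1 + (i j).-1))%N.
  by rewrite big_split /= sum1_card card_ord.
by apply: eq_bigr => j _; rewrite add1n prednK.
Qed.

End Heisenberg.

(** * Universal properties and generating sets *)

Lemma alg_ext_exists (k : fieldType) (A B : algType k) (I : ideal A)
    (f : {lrmorphism A -> B}) : (forall x, I x -> f x = 0) ->
  exists g : {lrmorphism quot_alg I -> B}, forall a, g (alg_pi I a) = f a.
Proof.
move=> f0; exists (alg_lift f0 : {lrmorphism quot_alg I -> B}).
exact: alg_liftE.
Qed.

Lemma presented_ext_exists (k : fieldType) (G : choiceType) (B : algType k)
    (R : free_alg k G -> Prop) (R1 : ~ in_ideal R 1) (h : G -> B) :
  (forall x, R x -> free_lift h x = 0) ->
  exists f : {lrmorphism presented_alg R1 -> B},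
    forall g, f (presented_gen R1 g) = h g.
Proof.
move=> hR; have [f fE] := @alg_ext_exists k _ _ (gen_ideal R1)
  (free_lift h : {lrmorphism free_alg k G -> B}) (ideal_lift_vanish hR).
by exists f => g; rewrite [LHS]fE; apply: free_lift_gen.
Qed.

Section Generation.
Variables (k : fieldType).
Implicit Types A B : algType k.

Lemma in_subalg_image A B (f : {lrmorphism A -> B}) (S : A -> Prop)
    (T : B -> Prop) :
  (forall x, S x -> in_subalg T (f x)) ->
  forall x, in_subalg S x -> in_subalg T (f x).
Proof.
move=> ST x; elim=> {x} [x /ST //| |x y _ fx _ fy|x y _ fx _ fy|a x _ fx].
- by rewrite rmorph1; apply: subalg1.
- by rewrite linearD; apply: subalgD.
- by rewrite rmorphM; apply: subalgM.
- by rewrite linearZ; apply: subalgZ.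
Qed.

Lemma eq_in_subalg A B (f g : {lrmorphism A -> B}) (S : A -> Prop) :
  (forall x, S x -> f x = g x) -> forall x, in_subalg S x -> f x = g x.
Proof.
move=> fg x; elim=> {x} [x /fg //| |x y _ fx _ fy|x y _ fx _ fy|a x _ fx].
- by rewrite !rmorph1.
- by rewrite !linearD /= fx fy.
- by rewrite !rmorphM /= fx fy.
- by rewrite !linearZ /= fx.
Qed.

Lemma in_subalgX A (S : A -> Prop) x n : in_subalg S x -> in_subalg S (x ^+ n).
Proof.
move=> Sx; elim: n => [|n IH]; first by rewrite expr0; apply: subalg1.
by rewrite exprS; apply: subalgM.
Qed.

Lemma free_generated (G : choiceType) (x : free_alg k G) :
  in_subalg (fun y => exists g, y = free_gen k g) x.
Proof.
elim/Defs.free_span: x => [|x y|c m].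
(* [in_subalg] has no constructor for 0, which is obtained as [0 *: 1]. *)
- by rewrite -(scale0r 1); apply/subalgZ/subalg1.
- exact: subalgD.
apply: subalgZ; case: m; elim=> [|g s IH].
  have -> : free_mon k (FMonom [::]) = 1 :> free_alg k G.
    by rewrite [RHS]/GRing.one /= /free_one locked_withE /free_mon -fmoneE.
  exact: subalg1.
have -> : FMonom (g :: s) = mmul (fmu g) (FMonom s).
  by rewrite [RHS]fmmulE fmuE.
rewrite -free_monM; apply: subalgM IH.
by apply: subalg_mem; exists g.
Qed.

Lemma presented_generated (G : choiceType) (R : free_alg k G -> Prop)
    (R1 : ~ in_ideal R 1) (x : presented_alg R1) :
  in_subalg (fun y => exists g, y = presented_gen R1 g) x.
Proof.
case: (alg_pi_surj x) => y <-.
pose pi := alg_pi (gen_ideal R1) : {lrmorphism _ -> presented_alg R1}.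
apply: (in_subalg_image (f := pi)) (free_generated y).
by move=> _ [g ->]; apply: subalg_mem; exists g.
Qed.

End Generation.

(** * Commutator calculus *)

Section Commutators.
Variables (k : fieldType) (B : algType k).
Implicit Types (x y z s : B) (c : k).

Lemma lieMr x y z : lie x (y * z) = lie x y * z + y * lie x z.
Proof. by rewrite /lie mulrBl mulrBr !mulrA addrA subrK. Qed.

Lemma lieZr c x y : lie x (c *: y) = c *: lie x y.
Proof. by rewrite /lie -scalerAr -scalerAl scalerBr. Qed.

Lemma lieMl x y z : lie (x * y) z = x * lie y z + lie x z * y.
Proof. by rewrite /lie mulrBl mulrBr !mulrA addrA subrK. Qed.

Lemma lieDl x y z : lie (x + y) z = lie x z + lie y z.
Proof. by rewrite /lie mulrDl mulrDr opprD addrACA. Qed.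

Lemma lieC x y : lie x y = - lie y x.
Proof. by rewrite /lie opprB. Qed.

Lemma lieNl x y : lie (- x) y = - lie x y.
Proof. by rewrite /lie mulNr mulrN opprB opprK addrC. Qed.

Lemma liexx x : lie x x = 0.
Proof. exact: subrr. Qed.

(** [lie y] is a derivation, so eigenvalues add up along powers of an eigenvector. *)
Lemma lieX_scale c y s n : lie y s = c *: s ->
  lie y (s ^+ n) = (c * n%:R) *: s ^+ n.
Proof.
move=> ys; elim: n => [|n IH].
  by rewrite expr0 /lie mulr1 mul1r subrr mulr0 scale0r.
rewrite exprS lieMr ys IH -scalerAl -scalerAr -scalerDl.
by rewrite -{1}[c]mulr1 -mulrDr nat1r.
Qed.

(** On powers of [s] the derivation [lie x] acts as c s^2 d/ds. *)
Lemma lieX_square c x s n : lie x s = c *: s ^+ 2 ->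
  lie x (s ^+ n) = (c * n%:R) *: s ^+ n.+1.
Proof.
move=> xs; elim: n => [|n IH].
  by rewrite expr0 /lie mulr1 mul1r subrr mulr0 scale0r.
rewrite exprS lieMr xs IH -scalerAl -scalerAr -exprD -exprS -scalerDl.
by rewrite -{1}[c]mulr1 -mulrDr nat1r.
Qed.

End Commutators.

Lemma rmorph_lie (k : fieldType) (A B : algType k) (f : {lrmorphism A -> B}) a b :
  f (lie a b) = lie (f a) (f b).
Proof. by rewrite /lie rmorphB !rmorphM. Qed.

(** * The presentation of the quotient, and the biideal property *)

Section HeisenbergPresentation.
Variables (k : fieldType) (lam : k).
Hypothesis two_neq0 : 2%:R != 0 :> k.
Local Notation X := (heis_X lam).
Local Notation Y := (heis_Y lam).
Local Notation t := (heis_t lam).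
Local Notation p := (alg_pi (heis_ideal lam)).
Local Notation P := (presented_alg (heis_rel_proper lam)).
Local Notation pgen := (presented_gen (heis_rel_proper lam)).

Lemma heis_YXE : lie Y X = lam *: X.
Proof. by rewrite -rmorph_lie cm_YXE linearZ. Qed.

Lemma heis_YtE : lie Y t = lam *: t.
Proof.
rewrite lieZr -rmorph_lie cm_YtE // mulr1 linearZ /= scalerA mulrC.
by rewrite -scalerA.
Qed.

(** With u the class of t_2, the relation for [X, t_2] becomes [X, u] = λ(3u^2 - 2u^2) = λu^2; then
    substitute t = 2u. *)
Lemma heis_XtE : lie X t = (2%:R^-1 * lam) *: t ^+ 2.
Proof.
rewrite lieZr -rmorph_lie cm_XtE // linearZ linearB /= !linearZ /=.
rewrite heis_tE // rmorphM /= -expr2 scalerN -scalerBl /heis_t.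
rewrite exprZn !scalerA; congr (_ *: _).
rewrite -natrB // mulr1 expr2 [2%:R^-1 * lam]mulrC -!mulrA mulKf //.
Qed.

Lemma heis_generated (a : heis lam) :
  in_subalg (fun x => [\/ x = X, x = Y | x = t]) a.
Proof.
case: (alg_pi_surj a) => b <-.
apply: (@in_subalg_image _ _ _ (p : {lrmorphism HCM lam -> heis lam}) _ _ _ _
  (presented_generated b)) => _ [[| |n] ->].
- by apply: subalg_mem; constructor 1.
- by apply: subalg_mem; constructor 2.
(* [genT n] is t_(n+1), whose class is the n-th power of t/2. *)
rewrite -[X in in_subalg _ X]/(p (cm_t lam n.+1)) heis_tE //; apply: in_subalgX.
have -> : p (cm_t lam 2) = 2%:R^-1 *: t by rewrite scalerA mulVf // scale1r.
by apply/subalgZ/subalg_mem; constructor 3.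
Qed.

(** Sending t_n to (z/2)^(n-1) respects all relations and kills the ideal. It serves twice: with [B]
    the presented algebra for the inverse of the presentation map, and with [B] the converse algebra
    for the antipode. *)
Lemma heis_lift_exists (B : algType k) (x y z : B) :
  lie y x = lam *: x -> lie x z = (2%:R^-1 * lam) *: z ^+ 2 ->
  lie y z = lam *: z ->
  exists g : {lrmorphism heis lam -> B}, [/\ g X = x, g Y = y & g t = z].
Proof.
move=> yx xz yz; pose s := 2%:R^-1 *: z.
have ys : lie y s = lam *: s by rewrite lieZr yz !scalerA mulrC.
have xs : lie x s = lam *: s ^+ 2.
  rewrite lieZr xz exprZn !scalerA; congr (_ *: _).
  by rewrite expr2 mulrA mulrC.
pose h g := match g with genX => x | genY => y | genT n => s ^+ n end.
have [f fE] : exists f : {lrmorphism HCM lam -> B},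
    forall g, f (presented_gen (cm_proper lam) g) = h g.
  apply: presented_ext_exists => w.
  have hX : free_lift h (free_gen k genX) = x by rewrite free_lift_gen.
  have hY : free_lift h (free_gen k genY) = y by rewrite free_lift_gen.
  have hT n : (1 <= n)%N -> free_lift h (free_t k n) = s ^+ n.-1.
    by rewrite free_lift_gen.
  have hL a b : free_lift h (lie a b) = lie (free_lift h a) (free_lift h b).
    exact: rmorph_lie.
  have hB a b : free_lift h (a - b) = free_lift h a - free_lift h b.
    exact: linearB.
  have hZ c a : free_lift h (c *: a) = c *: free_lift h a by exact: linearZ.
  have hM a b : free_lift h (a * b) = free_lift h a * free_lift h b.
    exact: rmorphM.
  case=> [|m n m1 n1||n n1|n n1].
  - have h1 : free_lift h 1 = 1 by exact: rmorph1.
    by rewrite hB hT // h1 subrr.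
  - by rewrite hL !hT // /lie -!exprD addnC subrr.
  - by rewrite hB hL hZ hX hY yx subrr.
  - by rewrite hB hL hZ hY !hT // (lieX_scale _ ys) subrr.
  (* All terms are multiples of s^n, and the coefficients agree since (n+1) - 2 = n - 1. *)
  rewrite hB hL hX !hZ hB !hZ hM !hT // (lieX_square _ xs).
  rewrite -exprD add1n prednK // -scalerBl scalerA.
  by rewrite -natrB // subSS subn1 subrr.
have f0 w : heis_ideal lam w -> f w = 0.
  apply: ideal_lift_vanish => {}w [n n3 ->].
  rewrite linearB rmorphXn /= !fE /= expr1.
  by rewrite subrr.
have [g gE] := alg_ext_exists f0.
exists g; rewrite /heis_t linearZ /= !gE !fE /=; split=> //.
by rewrite expr1 scalerA mulfV // scale1r.
Qed.

(** The universal properties give morphisms both ways; their composites fix the generators, hence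
    are identities. *)
Lemma heis_presentation : exists f : {lrmorphism P -> heis lam},
  [/\ bijective f, f (pgen heisX) = X, f (pgen heisY) = Y
    & f (pgen heisT) = t].
Proof.
pose h g := match g with heisX => X | heisY => Y | heisT => t end.
have [f fE] : exists f : {lrmorphism P -> heis lam}, forall g, f (pgen g) = h g.
  apply: presented_ext_exists => w.
  have hg a : free_lift h (free_gen k a) = h a by rewrite free_lift_gen.
  have hL a b : free_lift h (lie a b) = lie (free_lift h a) (free_lift h b).
    exact: rmorph_lie.
  have hB a b : free_lift h (a - b) = free_lift h a - free_lift h b.
    exact: linearB.
  have hZ c a : free_lift h (c *: a) = c *: free_lift h a by exact: linearZ.
  have hX a n : free_lift h (a ^+ n) = free_lift h a ^+ n by exact: rmorphXn.
  case; rewrite hB hL !hZ ?hX !hg /=.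
  - by rewrite heis_YXE subrr.
  - by rewrite heis_XtE subrr.
  - by rewrite heis_YtE subrr.
have q0 x : heis_rel lam x -> alg_pi (gen_ideal (heis_rel_proper lam)) x = 0.
  by move=> Rx; apply/alg_pi_eq0/ideal_mem.
have [g [gX gY gT]] : exists g : {lrmorphism heis lam -> P},
    [/\ g X = pgen heisX, g Y = pgen heisY & g t = pgen heisT].
  apply: heis_lift_exists; apply/eqP; rewrite -subr_eq0; apply/eqP.
  - by have := q0 _ (heis_YX lam); rewrite linearB linearZ /= rmorph_lie.
  - by have := q0 _ (heis_Xt lam); rewrite linearB linearZ /= rmorphXn rmorph_lie.
  - by have := q0 _ (heis_Yt lam); rewrite linearB linearZ /= rmorph_lie.
exists f; split; rewrite ?fE //; exists g => x.
  apply: (eq_in_subalg (f := g \o f) (g := idfun) _ (presented_generated x)).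
  by move=> _ [[] ->] /=; rewrite fE.
apply: (eq_in_subalg (f := f \o g) (g := idfun) _ (heis_generated x)).
by move=> _ [] -> /=; rewrite ?(gX, gY, gT) fE.
Qed.

(** The coproducts of t_n and t_2^(n-1) have the same image (u ⊗ 1 + 1 ⊗ u)^(n-1), u being the class
    of t_2, and both counits vanish as n >= 3. *)
Lemma heis_biideal (H : hopf_algebra (HCM lam)) :
  is_cm_hopf H -> biideal H (heis_ideal lam).
Proof.
move=> [[_ _ cT] [_ _ eT] _]; apply: biideal_gen => _ [n n3 ->].
  have [c1 cM] := comul_monoid H.
  have [t1 tM] := @tens_map_pi_monoid _ _ (heis_ideal lam).
  have lpp := tens_map_linear (@pi_linear k _ (heis_ideal lam))
    (@pi_linear k _ (heis_ideal lam)).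
  have cX a m : tens_map p p (comul H (a ^+ m)) = tens_map p p (comul H a) ^+ m.
    elim: m => [|m IH]; first by rewrite !expr0 c1 t1.
    by rewrite !exprS cM tM IH.
  have n1 : (1 <= n)%N by apply: ltnW (ltnW n3).
  have -> : cm_t lam n - cm_t lam 2 ^+ n.-1 = (-1) *: cm_t lam 2 ^+ n.-1 + cm_t lam n.
    by rewrite scaleN1r addrC.
  have ct m : (1 <= m)%N -> tens_map p p (comul H (cm_t lam m))
      = (p (cm_t lam 2) ⊗ 1 + 1 ⊗ p (cm_t lam 2)) ^+ m.-1.
    by move=> m1; rewrite cT //; apply: tens_map_comul_t.
  by rewrite linearP lpp cX (ct n n1) (ct 2%N isT) expr1 scaleN1r addNr.
rewrite rmorphB rmorphXn /= !eT ?(ltnW (ltnW n3)) //.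
by case: n n3 => [|[|[|n]]] // _; rewrite expr0n subrr.
Qed.

End HeisenbergPresentation.

(** * Coproducts of (skew-)primitive elements in the quotient *)

Lemma comul_primitiveZ (k : fieldType) (A : algType k) (B : bialgebra A) c a :
  comul B a = a ⊗ 1 + 1 ⊗ a ->
  comul B (c *: a) = (c *: a) ⊗ 1 + 1 ⊗ (c *: a).
Proof.
move=> ca; rewrite linearZ /= ca scalerDr.
have := (tpure_bilinear A A).1 1 c a 0; have := (tpure_bilinear A A).2 1 c a 0.
rewrite !addr0 (linear_map0 ((tpure_bilinear A A).1 1)).
rewrite (linear_map0 ((tpure_bilinear A A).2 1)).
move: (1 ⊗ _) (_ ⊗ 1) (1 ⊗ a) (a ⊗ 1) => x y z w.
by rewrite !addr0 => -> ->.
Qed.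

Section QuotientCoproduct.
Variables (k : fieldType) (A : algType k) (H : bialgebra A) (I : ideal A).
Variable bI : biideal H I.
Local Notation p := (alg_pi I).
Local Notation Q := (quot_bialgebra bI).

Let lp := @pi_linear k A I.

Let tens_map_primitive a :
  tens_map p p (a ⊗ 1 + 1 ⊗ a) = p a ⊗ 1 + 1 ⊗ p a.
Proof.
have := tens_map_linear lp lp 1 (a ⊗ 1) (1 ⊗ a); rewrite !scale1r => ->.
by rewrite !(tens_mapE _ _ lp lp) rmorph1.
Qed.

Lemma quot_primitive a : comul H a = a ⊗ 1 + 1 ⊗ a ->
  comul Q (p a) = p a ⊗ 1 + 1 ⊗ p a.
Proof. by move=> ca; rewrite [LHS](quot_comulE bI) ca tens_map_primitive. Qed.

Lemma quot_skew_primitive a b c : comul H a = a ⊗ 1 + 1 ⊗ a + b ⊗ c ->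
  comul Q (p a) = 1 ⊗ p a + p a ⊗ 1 + p b ⊗ p c.
Proof.
move=> ca; rewrite [LHS](quot_comulE bI) ca.
have := tens_map_linear lp lp 1 (a ⊗ 1 + 1 ⊗ a) (b ⊗ c); rewrite !scale1r => ->.
rewrite (tens_map_primitive a) (tens_mapE b c lp lp).
move: (p a ⊗ 1) (1 ⊗ p a) (p b ⊗ p c) => x y z.
by rewrite [x + y]addrC.
Qed.

End QuotientCoproduct.

(** * The antipode of the quotient *)

Section HeisenbergAntipode.
Variables (k : fieldType) (lam : k).
Hypothesis two_neq0 : 2%:R != 0 :> k.
Local Notation X := (heis_X lam).
Local Notation Y := (heis_Y lam).
Local Notation t := (heis_t lam).
Local Notation p := (alg_pi (heis_ideal lam)).

(** The commutator of the converse algebra is [lie] with its arguments exchanged, so the three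
    Heisenberg relations are checked on the images with reversed brackets. *)
Lemma heis_antipode_exists : exists S : {lrmorphism heis lam -> (heis lam)^c},
  [/\ S X = - X + Y * t, S Y = - Y & S t = - t].
Proof.
have hYX := heis_YXE lam; have hXt := heis_XtE lam two_neq0.
have hYt := heis_YtE lam.
have lieNr (x y : heis lam) : lie x (- y) = - lie x y.
  by rewrite -scaleN1r lieZr scaleN1r.
have lie_xy : lie (- X + Y * t) (- Y) = lam *: (- X + Y * t).
  rewrite lieNr lieDl lieNl lieMl liexx mul0r addr0 [lie X Y]lieC [lie t Y]lieC.
  by rewrite hYX hYt mulrN opprD !opprK scalerDr scalerN -scalerAr.
(* The part -X contributes -(λ/2)t^2 and the part Yt contributes λt^2. *)
have lie_zx : lie (- t) (- X + Y * t) = (2%:R^-1 * lam) *: (- t) ^+ 2.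
  rewrite lieNl lieC opprK lieDl lieNl lieMl liexx mulr0 add0r hXt hYt.
  rewrite -scalerAl -expr2 sqrrN -scaleNr -scalerDl; congr (_ *: _).
  have : 2%:R^-1 * lam + 2%:R^-1 * lam = lam.
    by rewrite -mulrDl -mulr2n -[X in X * _ = _]mulr_natr mulVf // mul1r.
  by move=> {2}<-; rewrite addKr.
have lie_zy : lie (- t) (- Y) = lam *: (- t).
  by rewrite lieNl lieNr opprK lieC hYt scalerN.
exact: (@heis_lift_exists k lam two_neq0 (heis lam)^c _ _ _ lie_xy lie_zx lie_zy).
Qed.

End HeisenbergAntipode.

Theorem corollary4p3 (k : fieldType) (char0 : [pchar k] =i pred0) (lam : k)
    (H : hopf_algebra (HCM lam)) (H_cm : is_cm_hopf H) :
  let X := heis_X lam in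
  let Y := heis_Y lam in
  let t := heis_t lam in
  exists (bI : biideal H (heis_ideal lam)) (K : hopf_algebra (heis lam)),
  [/\ hopf_bialgebra K = quot_bialgebra bI,
      forall a : heis lam,
        in_subalg (fun x => [\/ x = X, x = Y | x = t]) a,
      [/\ lie Y X = lam *: X,
          lie X t = (2%:R^-1 * lam) *: t ^+ 2
        & lie Y t = lam *: t],
      exists f : {lrmorphism presented_alg (heis_rel_proper lam) -> heis lam},
        [/\ bijective f,
            f (presented_gen (heis_rel_proper lam) heisX) = X,
            f (presented_gen (heis_rel_proper lam) heisY) = Y
          & f (presented_gen (heis_rel_proper lam) heisT) = t]
    & [/\ [/\ comul K X = 1 ⊗ X + X ⊗ 1 + Y ⊗ t,
              comul K Y = Y ⊗ 1 + 1 ⊗ Y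
            & comul K t = t ⊗ 1 + 1 ⊗ t],
          [/\ antipode K Y = - Y,
              antipode K X = - X + Y * t
            & antipode K t = - t]
        & [/\ counit K X = 0, counit K Y = 0 & counit K t = 0]]].

Proof.
(* As 2 is prime, its not being a characteristic of [k] means that it is nonzero in [k]. *)
have two_neq0 : 2%:R != 0 :> k by have := char0 2%N; rewrite !inE /= => ->.
move=> X Y t; have bI := heis_biideal H_cm.
have [S [SX SY St]] := heis_antipode_exists lam two_neq0.
(* Read as a map into [heis lam] itself, [S] is anti-multiplicative. *)
pose Sf : heis lam -> heis lam := S.
have lS : linear Sf by exact: (linearP S).
have SM x y : Sf (x * y) = Sf y * Sf x by exact: (rmorphM S x y).
have S1 : Sf 1 = 1 by exact: (rmorph1 S).
have [[cX cY cT] [eX eY eT] _] := H_cm.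
pose B := quot_bialgebra bI.
have BX : comul B X = 1 ⊗ X + X ⊗ 1 + Y ⊗ t.
  by have := quot_skew_primitive bI cX; rewrite alg_piZ.
have BY : comul B Y = Y ⊗ 1 + 1 ⊗ Y by exact: quot_primitive cY.
have Bt : comul B t = t ⊗ 1 + 1 ⊗ t.
  (* The class of t_2 is primitive: this is [tens_map_comul_t] at n = 2, where the exponent is 1. *)
  apply: comul_primitiveZ; apply: (etrans (quot_comulE bI _)).
  rewrite (cT 2%N isT).
  rewrite (@tens_map_comul_t k lam 2%N isT).
  rewrite expr1.
  reflexivity.
have eBX : (counit B X : k) = 0 by apply: (etrans (quot_counitE bI _)).
have eBY : (counit B Y : k) = 0 by apply: (etrans (quot_counitE bI _)).
have eBt : (counit B t : k) = 0.
  have e : (counit B (alg_pi (heis_ideal lam) (cm_t lam 2)) : k) = 0.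
    by apply: (etrans (quot_counitE bI _)); apply: eT 2%N isT.
  apply: (etrans (linearZ_LR (counit B) _ _)).
  by apply: (etrans (congr1 _ e)); apply: mulr0.
have [a [-> | -> | ->]|K KB KS] := hopf_from_generators lS S1 SM (@heis_generated k lam two_neq0) (B := B).
- exact: antipode_at_skew_primitive BX eBX SX SY St.
- exact: antipode_at_primitive BY eBY SY.
- exact: antipode_at_primitive Bt eBt St.
exists bI, K; split.
- exact: KB.
- exact: heis_generated.
- by split; [apply: heis_YXE | apply: heis_XtE | apply: heis_YtE].
- exact: heis_presentation.
rewrite KB; split; split.
- exact: BX.
- exact: BY.
- exact: Bt.
- exact: (etrans (KS Y) SY).
- exact: (etrans (KS X) SX).
- exact: (etrans (KS t) St).
- exact: eBX.
- exact: eBY.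
- exact: eBt.
Qed.
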